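(* Assume that $\mathrm{ZF}$ is consistent. Then $\mathrm{IZF}_{Ref}$ does not prove the statement ''every Cauchy sequence of Cauchy sequences (of rationals) converges to a Cauchy sequence (of rationals)''.
   Context: $\mathrm{IZF}_{Ref}$ is the theory in first-order intuitionistic logic with equality, in the language $\{\in\}$, with axioms: Extensionality, Empty Set, Pairing, Union, Infinity, Power Set, the Set Induction schema $(\forall x\,((\forall y\in x\;\phi(y))\to\phi(x)))\to\forall x\,\phi(x)$, the full Separation schema, and the Reflection schema: for every formula $\phi(x)$ (possibly with parameters) and every set $z$ there is a transitive set $Z$ containing $z$ and the parameters such that for all $x\in Z$, $\phi(x)$ holds iff $\phi(x)$ holds relativized to $Z$. (It is IZF with Collection replaced by Reflection.) The following notions are formalized in the language of set theory. A Cauchy sequence (of rationals) is a function $X:\mathbb N\to\mathbb Q$ such that for every positive rational $\epsilon$ there is $N\in\mathbb N$ with $|X(n)-X(m)|<\epsilon$ for all $m,n>N$ (no modulus of convergence is required). For Cauchy sequences $x,y$, the distance $d(x,y)$ is the sequence $n\mapsto|x(n)-y(n)|$; $x<y$ means that there are $m,N\in\mathbb N$, $m\ge 1$, with $x(k)+1/m<y(k)$ for all $k>N$; a rational is identified with the corresponding constant sequence. A sequence $\langle X_j\mid j\in\mathbb N\rangle$ of Cauchy sequences is Cauchy if for every positive rational $\epsilon$ there is $N$ with $d(X_j,X_k)<\epsilon$ for all $j,k>N$; it converges to a Cauchy sequence $Y$ if for every positive rational $\epsilon$ there is $N$ with $d(X_j,Y)<\epsilon$ for all $j>N$. *)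

(* Defs.v *)
From Stdlib Require Import List.
Import ListNotations.

Set Implicit Arguments.

(** De Bruijn syntax.  The language has no function symbols, so terms are
    variables and substitution is renaming. *)
Inductive fm : Type :=
| FFal : fm
| FEq  : nat -> nat -> fm
| FMem : nat -> nat -> fm
| FAnd : fm -> fm -> fm
| FOr  : fm -> fm -> fm
| FImp : fm -> fm -> fm
| FAll : fm -> fm
| FEx  : fm -> fm.

Definition scons {A : Type} (x : A) (s : nat -> A) (i : nat) : A :=
  match i with 0 => x | S j => s j end.

Definition up (r : nat -> nat) : nat -> nat := scons 0 (fun i => S (r i)).

Fixpoint ren (r : nat -> nat) (p : fm) : fm :=
  match p with
  | FFal => FFal
  | FEq i j => FEq (r i) (r j)
  | FMem i j => FMem (r i) (r j)
  | FAnd p q => FAnd (ren r p) (ren r q)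
  | FOr p q => FOr (ren r p) (ren r q)
  | FImp p q => FImp (ren r p) (ren r q)
  | FAll p => FAll (ren (up r) p)
  | FEx p => FEx (ren (up r) p)
  end.

Definition shift : fm -> fm := ren S.

(** [inst i p] is p with variable 0 replaced by variable i (and the other
    variables lowered). *)
Definition inst (i : nat) : fm -> fm := ren (scons i (fun j => j)).

(** Intuitionistic natural deduction over a set T of axioms.  The free
    variables of an axiom are read as universally quantified: [prv_AllI] shifts
    the local hypotheses but leaves T unchanged. *)
Inductive prv (T : fm -> Prop) : list fm -> fm -> Prop :=
| prv_Ax G p : T p -> prv T G p
| prv_Hyp G p : In p G -> prv T G p
| prv_FalE G p : prv T G FFal -> prv T G p
| prv_AndI G p q : prv T G p -> prv T G q -> prv T G (FAnd p q)
| prv_AndE1 G p q : prv T G (FAnd p q) -> prv T G p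
| prv_AndE2 G p q : prv T G (FAnd p q) -> prv T G q
| prv_OrI1 G p q : prv T G p -> prv T G (FOr p q)
| prv_OrI2 G p q : prv T G q -> prv T G (FOr p q)
| prv_OrE G p q r :
    prv T G (FOr p q) -> prv T (p :: G) r -> prv T (q :: G) r -> prv T G r
| prv_ImpI G p q : prv T (p :: G) q -> prv T G (FImp p q)
| prv_ImpE G p q : prv T G (FImp p q) -> prv T G p -> prv T G q
| prv_AllI G p : prv T (map shift G) p -> prv T G (FAll p)
| prv_AllE G p i : prv T G (FAll p) -> prv T G (inst i p)
| prv_ExI G p i : prv T G (inst i p) -> prv T G (FEx p)
| prv_ExE G p q :
    prv T G (FEx p) -> prv T (p :: map shift G) (shift q) -> prv T G q
| prv_EqI G i : prv T G (FEq i i)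
| prv_EqE G p i j :
    prv T G (FEq i j) -> prv T G (inst i p) -> prv T G (inst j p).

Definition iprovable (T : fm -> Prop) (p : fm) : Prop := prv T [] p.

Inductive LEM : fm -> Prop :=
| LEM_intro p : LEM (FOr p (FImp p FFal)).

Definition cprovable (T : fm -> Prop) (p : fm) : Prop :=
  prv (fun q => T q \/ LEM q) [] p.

Definition cconsistent (T : fm -> Prop) : Prop := ~ cprovable T FFal.

(** Free variables, with repetitions. *)
Definition lower (l : list nat) : list nat :=
  flat_map (fun i => match i with 0 => [] | S j => [j] end) l.

Fixpoint fvs (p : fm) : list nat :=
  match p with
  | FFal => []
  | FEq i j | FMem i j => [i; j]
  | FAnd p q | FOr p q | FImp p q => fvs p ++ fvs q
  | FAll p | FEx p => lower (fvs p)
  end.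

(** Relativization to the set denoted by variable k. *)
Fixpoint rel (k : nat) (p : fm) : fm :=
  match p with
  | FFal => FFal
  | FEq i j => FEq i j
  | FMem i j => FMem i j
  | FAnd p q => FAnd (rel k p) (rel k q)
  | FOr p q => FOr (rel k p) (rel k q)
  | FImp p q => FImp (rel k p) (rel k q)
  | FAll p => FAll (FImp (FMem 0 (S k)) (rel (S k) p))
  | FEx p => FEx (FAnd (FMem 0 (S k)) (rel (S k) p))
  end.

(** A formula or a variable occurring in a context is a function of the number
    d of binders enclosing the occurrence.  A variable bound under l binders has
    index d - S l at depth d; the i-th free variable of the whole formula has
    index d + i. *)
Definition fb : Type := nat -> fm.
Definition var : Type := nat -> nat.

Definition bound (l : nat) : var := fun d => d - S l.
Definition param (i : nat) : var := fun d => d + i.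

Definition bFal : fb := fun _ => FFal.
Definition bEq (x y : var) : fb := fun d => FEq (x d) (y d).
Definition bMem (x y : var) : fb := fun d => FMem (x d) (y d).
Definition bAnd (p q : fb) : fb := fun d => FAnd (p d) (q d).
Definition bOr (p q : fb) : fb := fun d => FOr (p d) (q d).
Definition bImp (p q : fb) : fb := fun d => FImp (p d) (q d).
Definition bAll (f : var -> fb) : fb := fun d => FAll (f (bound d) (S d)).
Definition bEx (f : var -> fb) : fb := fun d => FEx (f (bound d) (S d)).
Definition bIff (p q : fb) : fb := bAnd (bImp p q) (bImp q p).
Definition bNot (p : fb) : fb := bImp p bFal.

Definition formula (p : fb) : fm := p 0.

(** [emb p s]: the formula p with its i-th free variable replaced by [s i]. *)
Definition emb (p : fm) (s : nat -> var) : fb := fun d => ren (fun i => s i d) p.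

(** The relativization p^Z. *)
Definition bRel (Z : var) (p : fb) : fb := fun d => rel (Z d) (p d).

Definition bConj (l : list fb) : fb := fold_right bAnd (bNot bFal) l.

Declare Scope fm_scope.
Delimit Scope fm_scope with fm.
Bind Scope fm_scope with fb.

Notation "x ≐ y" := (bEq x y) (at level 70) : fm_scope.
Notation "x ∈ y" := (bMem x y) (at level 70) : fm_scope.
Notation "¬ p" := (bNot p) (at level 75, right associativity) : fm_scope.
Notation "p ∧ q" := (bAnd p q) (at level 80, right associativity) : fm_scope.
Notation "p ∨ q" := (bOr p q) (at level 85, right associativity) : fm_scope.
Notation "p → q" := (bImp p q) (at level 90, right associativity) : fm_scope.
Notation "p ↔ q" := (bIff p q) (at level 95) : fm_scope.
Notation "∀ x , p" := (bAll (fun x : var => p%fm))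
  (at level 200, x name, p at level 200) : fm_scope.
Notation "∃ x , p" := (bEx (fun x : var => p%fm))
  (at level 200, x name, p at level 200) : fm_scope.
Notation "∀ x ∈ y , p" := (bAll (fun x : var => bImp (bMem x y) p%fm))
  (at level 200, x name, y at level 69, p at level 200) : fm_scope.
Notation "∃ x ∈ y , p" := (bEx (fun x : var => bAnd (bMem x y) p%fm))
  (at level 200, x name, y at level 69, p at level 200) : fm_scope.

Notation "∀ x :: A , p" := (bAll (fun x : var => bImp (A x) p%fm))
  (at level 200, x name, A at level 69, p at level 200) : fm_scope.
Notation "∃ x :: A , p" := (bEx (fun x : var => bAnd (A x) p%fm))
  (at level 200, x name, A at level 69, p at level 200) : fm_scope.

Local Open Scope fm_scope.

Definition class : Type := var -> fb.

(** A set-theoretic term t is given by its graph: [t x] says x = t. *)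
Definition term : Type := var -> fb.

(** p holds of the value of t. *)
Notation "'LET' x := t 'IN' p" := (bEx (fun x : var => bAnd (t x) p%fm))
  (at level 200, x name, t at level 100, p at level 200) : fm_scope.

Definition ex1 (f : var -> fb) : fb := ∃ x, f x ∧ (∀ y, f y → y ≐ x).

Definition t_empty : term := fun x => ∀ y, ¬ y ∈ x.
Definition t_succ (x : var) : term := fun s => ∀ t, t ∈ s ↔ t ∈ x ∨ t ≐ x.
Definition subset (x y : var) : fb := ∀ z ∈ x, z ∈ y.
Definition transitive (x : var) : fb := ∀ y ∈ x, ∀ z ∈ y, z ∈ x.
Definition inductive (w : var) : fb :=
  (LET z := t_empty IN z ∈ w) ∧ (∀ x ∈ w, LET s := t_succ x IN s ∈ w).

Definition ax_ext : fb := ∀ x, ∀ y, (∀ z, z ∈ x ↔ z ∈ y) → x ≐ y.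
Definition ax_empty : fb := ∃ x, t_empty x.
Definition ax_pair : fb := ∀ x, ∀ y, ∃ z, ∀ u, u ∈ z ↔ u ≐ x ∨ u ≐ y.
Definition ax_union : fb := ∀ x, ∃ z, ∀ u, u ∈ z ↔ ∃ y ∈ x, u ∈ y.
Definition ax_infinity : fb := ∃ w, inductive w.
Definition ax_power : fb := ∀ x, ∃ z, ∀ u, u ∈ z ↔ subset u x.
Definition ax_foundation : fb :=
  ∀ x, (∃ y, y ∈ x) → ∃ y ∈ x, ¬ (∃ z ∈ x, z ∈ y).

(** In the schemas, variable 0 of p is the distinguished variable x (for
    replacement, 0 is x and 1 is y) and the remaining ones are parameters. *)
Definition emb1 (p : fm) (x : var) : fb := emb p (scons x param).
Definition emb2 (p : fm) (x y : var) : fb := emb p (scons x (scons y param)).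

Definition ax_induction (p : fm) : fb :=
  (∀ x, (∀ y ∈ x, emb1 p y) → emb1 p x) → ∀ x, emb1 p x.

Definition ax_separation (p : fm) : fb :=
  ∀ a, ∃ b, ∀ x, x ∈ b ↔ x ∈ a ∧ emb1 p x.

Definition ax_replacement (p : fm) : fb :=
  ∀ a, (∀ x ∈ a, ex1 (fun y => emb2 p x y)) →
       ∃ b, ∀ y, y ∈ b ↔ ∃ x ∈ a, emb2 p x y.

(** [lower (fvs p)] lists the parameters of p, i.e. its free variables other
    than variable 0, numbered as [param] numbers them. *)
Definition ax_reflection (p : fm) : fb :=
  ∀ z, ∃ Z, transitive Z ∧ z ∈ Z
    ∧ bConj (map (fun i => param i ∈ Z) (lower (fvs p)))
    ∧ (∀ x ∈ Z, emb1 p x ↔ bRel Z (emb1 p x)).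

Inductive IZFRef : fm -> Prop :=
| IZFRef_ext : IZFRef (formula ax_ext)
| IZFRef_empty : IZFRef (formula ax_empty)
| IZFRef_pair : IZFRef (formula ax_pair)
| IZFRef_union : IZFRef (formula ax_union)
| IZFRef_infinity : IZFRef (formula ax_infinity)
| IZFRef_power : IZFRef (formula ax_power)
| IZFRef_induction p : IZFRef (formula (ax_induction p))
| IZFRef_separation p : IZFRef (formula (ax_separation p))
| IZFRef_reflection p : IZFRef (formula (ax_reflection p)).

Inductive ZF : fm -> Prop :=
| ZF_ext : ZF (formula ax_ext)
| ZF_empty : ZF (formula ax_empty)
| ZF_pair : ZF (formula ax_pair)
| ZF_union : ZF (formula ax_union)
| ZF_infinity : ZF (formula ax_infinity)
| ZF_power : ZF (formula ax_power)
| ZF_foundation : ZF (formula ax_foundation)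
| ZF_separation p : ZF (formula (ax_separation p))
| ZF_replacement p : ZF (formula (ax_replacement p)).

Definition t_upair (x y : var) : term := fun u => ∀ t, t ∈ u ↔ t ≐ x ∨ t ≐ y.

(** Kuratowski: (x, y) = {{x}, {x, y}}. *)
Definition t_pair (x y : var) : term := fun p =>
  ∀ u, u ∈ p ↔ t_upair x x u ∨ t_upair x y u.

Definition t_app (f x : var) : term := fun y => LET p := t_pair x y IN p ∈ f.

(** f is (the set-theoretic graph of) a function from A to B. *)
Definition maps (f : var) (A B : class) : fb :=
  (∀ p ∈ f, ∃ x :: A, ∃ y :: B, t_pair x y p) ∧
  (∀ x :: A, ex1 (fun y => t_app f x y)).

(** The natural numbers are the von Neumann ones, with m < n being m ∈ n. *)
Definition Nat : class := fun n => ∀ w, inductive w → n ∈ w.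

(** The value at n of the function on the natural numbers defined by recursion
    from f(0) = a and f(i+1) = g(f(i)). *)
Definition t_iter (a : term) (g : var -> term) (n : var) : term := fun k =>
  ∃ f, maps f Nat Nat
    ∧ (LET z := t_empty IN LET y := t_app f z IN a y)
    ∧ (∀ i :: Nat, LET s := t_succ i IN LET y := t_app f i IN
         LET y' := t_app f s IN g y y')
    ∧ t_app f n k.

Definition t_var (x : var) : term := fun y => y ≐ x.
Definition t_add (m n : var) : term := t_iter (t_var m) t_succ n.
Definition t_mul (m n : var) : term := t_iter t_empty (fun y => t_add y m) n.

(** a b + c d *)
Definition t_mulmul (a b c d : var) : term := fun k =>
  LET u := t_mul a b IN LET v := t_mul c d IN t_add u v k.

Definition PNat : class := fun n => Nat n ∧ ¬ t_empty n.

(** The rationals are the equivalence classes of triples ((a, b), c) of natural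
    numbers with c > 0, where ((a, b), c) stands for (a - b) / c.
    [t_frac a b c] is the class of ((a, b), c). *)
Definition t_triple (a b c : var) : term := fun t =>
  LET p := t_pair a b IN t_pair p c t.

Definition frac_eq (a b c a' b' c' : var) : fb :=
  LET k := t_mulmul a c' b' c IN t_mulmul a' c b c' k.

Definition t_frac (a b c : var) : term := fun q =>
  Nat a ∧ Nat b ∧ PNat c ∧
  (∀ t, t ∈ q ↔ ∃ a' :: Nat, ∃ b' :: Nat, ∃ c' :: PNat,
                  t_triple a' b' c' t ∧ frac_eq a b c a' b' c').

Definition Rat : class := fun q => ∃ a, ∃ b, ∃ c, t_frac a b c q.

Definition rat_lt (q r : var) : fb :=
  ∃ a, ∃ b, ∃ c, ∃ a', ∃ b', ∃ c', t_frac a b c q ∧ t_frac a' b' c' r ∧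
    (LET k := t_mulmul a c' b' c IN LET l := t_mulmul a' c b c' IN k ∈ l).

Definition t_rat_add (q r : var) : term := fun s =>
  ∃ a, ∃ b, ∃ c, ∃ a', ∃ b', ∃ c', t_frac a b c q ∧ t_frac a' b' c' r ∧
    (LET x := t_mulmul a c' a' c IN LET y := t_mulmul b c' b' c IN
     LET z := t_mul c c' IN t_frac x y z s).

Definition t_rat_opp (q : var) : term := fun s =>
  ∃ a, ∃ b, ∃ c, t_frac a b c q ∧ t_frac b a c s.

(** 1 / m *)
Definition t_rat_inv (m : var) : term := fun q =>
  LET z := t_empty IN LET o := t_succ z IN t_frac o z m q.

Definition t_rat_zero : term := fun q =>
  LET z := t_empty IN LET o := t_succ z IN t_frac z z o q.

Definition PRat : class := fun q =>
  Rat q ∧ (LET z := t_rat_zero IN rat_lt z q).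

Definition t_rat_abs (q : var) : term := fun s =>
  LET z := t_rat_zero IN
    (rat_lt q z ∧ t_rat_opp q s) ∨ (Rat q ∧ ¬ rat_lt q z ∧ s ≐ q).

(** |q - r| *)
Definition t_rat_dist (q r : var) : term := fun s =>
  LET r' := t_rat_opp r IN LET u := t_rat_add q r' IN t_rat_abs u s.

Definition CauchySeq : class := fun X =>
  maps X Nat Rat ∧
  (∀ e :: PRat, ∃ N :: Nat, ∀ n :: Nat, ∀ m :: Nat, N ∈ n ∧ N ∈ m →
     LET q := t_app X n IN LET r := t_app X m IN
     LET s := t_rat_dist q r IN rat_lt s e).

(** d(x, y), as a function on the natural numbers *)
Definition t_seq_dist (x y : var) : term := fun D =>
  maps D Nat Rat ∧
  (∀ n :: Nat, LET q := t_app x n IN LET r := t_app y n IN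
     LET s := t_rat_dist q r IN t_app D n s).

Definition t_seq_const (q : var) : term := fun E =>
  maps E Nat Rat ∧ (∀ n :: Nat, t_app E n q).

Definition seq_lt (x y : var) : fb :=
  ∃ m :: PNat, ∃ N :: Nat, ∀ k :: Nat, N ∈ k →
    LET q := t_app x k IN LET r := t_app y k IN LET i := t_rat_inv m IN
    LET s := t_rat_add q i IN rat_lt s r.

(** d(x, y) < e, for a rational e *)
Definition dist_lt (x y e : var) : fb :=
  LET D := t_seq_dist x y IN LET E := t_seq_const e IN seq_lt D E.

Definition CauchySeqSeq : class := fun X =>
  maps X Nat CauchySeq ∧
  (∀ e :: PRat, ∃ N :: Nat, ∀ j :: Nat, ∀ k :: Nat, N ∈ j ∧ N ∈ k →
     LET x := t_app X j IN LET y := t_app X k IN dist_lt x y e).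

Definition converges_to (X Y : var) : fb :=
  ∀ e :: PRat, ∃ N :: Nat, ∀ j :: Nat, N ∈ j →
    LET x := t_app X j IN dist_lt x Y e.

Definition cauchy_completeness : fm := formula
  (∀ X :: CauchySeqSeq, ∃ Y :: CauchySeq, converges_to X Y).

(* Main.v *)
From Stdlib Require Import List Arith Lia Reals Lra Classical ClassicalEpsilon.
From Stdlib Require Import RelationClasses Morphisms Setoid.
Require Import Defs.
Import ListNotations.

Set Implicit Arguments.
Unset Strict Implicit.

(** Intuitionistic set theory is interpreted in topological models.  A [space]
    is a set of points with an operator [near], to be read as: P holds on a
    neighbourhood of t.  A set of the model is a [name], a well-founded tree
    whose edges carry conditions on points, and [forces] evaluates a formula at
    a point; an implication or a universal statement is forced where it holds
    on a neighbourhood.  Provable formulas are forced everywhere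
    ([iprovable_forced]): [soundness] treats the logic, and the axioms hold
    over every space.  The delicate one is reflection, where a small family of
    names is closed under members and under witnesses ([closure_closed]), so
    that quantifying over the family is as good as quantifying over all names
    ([forces_reflect]).

    In such a model the natural numbers and the rationals are the standard
    ones, while a sequence of rationals is a sequence of locally constant
    functions of the point.  The lemmas [den_X] compute what the formulas of
    arithmetic say at a point, and [completeness_limit] extracts the external
    content of completeness: if F is a locally constant table of rationals
    whose rows are locally uniformly Cauchy and whose row limits are Cauchy in
    the corresponding sense, then near each point there are locally constant
    functions y_n that converge pointwise to the limit of the limits of the
    rows.

    The space that refutes this is the space of tables itself: a point is a
    sequence of bounded nondecreasing sequences of rationals (the rows), whose
    limits are eventually equal, and a neighbourhood of a table fixes a finite
    part of it and bounds the change of all the row limits.  Suppose that y_n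
    are as above near the zero table.  The key is that the limits cannot be
    told apart by locally constant functions, although the space is totally
    disconnected ([connected]): as in Erdos's proof that the space of rational
    points of Hilbert space has dimension one, a locally constant property of
    a row that holds for the zero row also holds for some row with any
    prescribed positive limit b.  So take a table with finitely many rows of
    limit b and all others zero.  Some late y_n is below b / 2 there, since the
    limits of the rows tend to 0.  Replace all the zero rows by one row of
    limit b without leaving the set where y_n < b / 2.  A neighbourhood of the
    new table lies in this set too, and fixes only finitely many rows; keep
    these, reset the others to zero and repeat ([spoil]).  The table that is
    built in this way has all limits equal to b, so it lies in all of these
    neighbourhoods and y_n < b / 2 there for infinitely many n, although y_n
    converges to b ([no_limit]). *)

(** * Forcing over a space of points *)

(** The axioms are those of the interior operator of a topology, [near t P]
    standing for: t is in the interior of P.  Points form a [Set], so that the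
    subsets of the space can index names. *)
Record space : Type := Space {
  point :> Set;
  near : point -> (point -> Prop) -> Prop;
  near_here : forall t (P : point -> Prop), near t P -> P t;
  near_all : forall t (P : point -> Prop), (forall s, P s) -> near t P;
  near_mono : forall t (P Q : point -> Prop),
    (forall s, P s -> Q s) -> near t P -> near t Q;
  near_and : forall t (P Q : point -> Prop),
    near t P -> near t Q -> near t (fun s => P s /\ Q s);
  near_near : forall t (P : point -> Prop),
    near t P -> near t (fun s => near s P) }.

Arguments near {s} t P.
Arguments near_here {s t P} _.
Arguments near_all {s t P} _.
Arguments near_mono {s t P Q} _ _.
Arguments near_and {s t P Q} _ _.
Arguments near_near {s t P} _.

Section Forcing.

Variable T : space.
Implicit Types t s : T.
Implicit Types P Q : T -> Prop.

(** The member [elt i] belongs to the name at the points near which [deg i]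
    holds; so [deg i] may be any set of points and stands for its interior. *)
Inductive name : Type :=
| Name (A : Type) (elt : A -> name) (deg : A -> T -> Prop).

Arguments Name : clear implicits.

Definition idx (x : name) : Type := let (A, _, _) := x in A.
Definition elt (x : name) : idx x -> name :=
  match x with Name _ f _ => f end.
Definition deg (x : name) : idx x -> T -> Prop :=
  match x with Name _ _ e => e end.

Arguments elt : clear implicits.
Arguments deg : clear implicits.

(** Mutual inclusion, with membership unfolded so that the recursion is
    structural; see [eq_at_ext]. *)
Fixpoint eqn (x y : name) : T -> Prop :=
  match x, y with
  | Name _ f d, Name _ g e => fun t => near t (fun s =>
      (forall i, near s (d i) -> exists j, near s (e j) /\ eqn (f i) (g j) s) /\
      (forall j, near s (e j) -> exists i, near s (d i) /\ eqn (f i) (g j) s))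
  end.

Definition eq_at t (x y : name) : Prop := eqn x y t.

Definition mem_at t (x y : name) : Prop :=
  exists j : idx y, near t (deg y j) /\ eq_at t x (elt y j).

Notation "x ==[ t ] y" := (eq_at t x y) (at level 70).
Notation "x \in[ t ] y" := (mem_at t x y) (at level 70).

Lemma eq_at_stable t x y : x ==[t] y -> near t (fun s => x ==[s] y).
Proof. destruct x, y. exact near_near. Qed.

Lemma mem_at_stable t x y : x \in[t] y -> near t (fun s => x \in[s] y).
Proof.
  intros (j & Hj & He).
  refine (near_mono _ (near_and (near_near Hj) (eq_at_stable He))).
  intros s [H1 H2]. now exists j.
Qed.

Lemma eq_at_refl t x : x ==[t] x.
Proof.
  revert t. induction x as [A f IH d]; intro t.
  apply near_all. intro s; split; intros i Hi; exists i; split; auto; apply IH.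
Qed.

Lemma eq_at_sym t x y : x ==[t] y -> y ==[t] x.
Proof.
  revert t y. induction x as [A f IH d]; intros t [B g e].
  apply near_mono. intros s [H1 H2]; split; intros i Hi.
  - destruct (H2 i Hi) as (j & Hj & E). exists j; split; [exact Hj | now apply IH].
  - destruct (H1 i Hi) as (j & Hj & E). exists j; split; [exact Hj | now apply IH].
Qed.

Lemma eq_at_trans t x y z : x ==[t] y -> y ==[t] z -> x ==[t] z.
Proof.
  revert t y z. induction x as [A f IH d]; intros t [B g e] [C h c] Hxy Hyz.
  refine (near_mono _ (near_and Hxy Hyz)). intros s [[H1 H2] [H3 H4]]; split.
  - intros i Hi. destruct (H1 i Hi) as (j & Hj & E). destruct (H3 j Hj) as (k & Hk & E').
    exists k; split; [exact Hk | exact (IH i s _ _ E E')].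
  - intros k Hk. destruct (H4 k Hk) as (j & Hj & E). destruct (H2 j Hj) as (i & Hi & E').
    exists i; split; [exact Hi | exact (IH i s _ _ E' E)].
Qed.

#[export] Instance eq_at_equiv t : Equivalence (eq_at t).
Proof.
  split; [exact (@eq_at_refl t) | exact (@eq_at_sym t) | exact (@eq_at_trans t)].
Qed.

Lemma elt_mem t x i : near t (deg x i) -> elt x i \in[t] x.
Proof. intro H. exists i. split; [exact H | reflexivity]. Qed.

Lemma mem_at_eq t x y z : x ==[t] y -> z \in[t] x -> z \in[t] y.
Proof.
  intros E (i & Hi & Ez). destruct x as [A f d], y as [B g e].
  destruct (near_here E) as [H _]. destruct (H i Hi) as (j & Hj & E').
  exists j. split; [exact Hj | exact (eq_at_trans Ez E')].
Qed.

#[export] Instance mem_at_proper t :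
  Proper (eq_at t ==> eq_at t ==> iff) (mem_at t).
Proof.
  assert (H : forall x x' y y', x ==[t] x' -> y ==[t] y' -> x \in[t] y -> x' \in[t] y').
  { intros x x' y y' Ex Ey (i & Hi & E). apply (mem_at_eq Ey).
    exists i. split; [exact Hi | now rewrite <- Ex]. }
  intros x x' Ex y y' Ey. split; apply H; trivial; now symmetry.
Qed.

Lemma eq_at_ext t x y :
  x ==[t] y <-> near t (fun s => forall z, z \in[s] x <-> z \in[s] y).
Proof.
  split.
  - intro E. refine (near_mono _ (eq_at_stable E)). intros s Es z. now rewrite Es.
  - destruct x as [A f d], y as [B g e]. apply near_mono. intros s H; split.
    + intros i Hi. apply (H (f i)). now exists i.
    + intros j Hj. destruct (proj2 (H (g j))) as (i & Hi & E).
      * now exists j.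
      * exists i. split; [exact Hi | exact (eq_at_sym E)].
Qed.

Fixpoint forces (r : nat -> name) (p : fm) (t : T) : Prop :=
  match p with
  | FFal => False
  | FEq i j => r i ==[t] r j
  | FMem i j => r i \in[t] r j
  | FAnd p q => forces r p t /\ forces r q t
  | FOr p q => forces r p t \/ forces r q t
  | FImp p q => near t (fun s => forces r p s -> forces r q s)
  | FAll p => near t (fun s => forall x, forces (scons x r) p s)
  | FEx p => exists x, forces (scons x r) p t
  end.

(** The truth values are open sets. *)
Lemma forces_stable p r t : forces r p t -> near t (forces r p).
Proof.
  revert r t. induction p; intros r t; cbn.
  - contradiction.
  - apply eq_at_stable.
  - apply mem_at_stable.
  - intros [H1 H2]. exact (near_and (IHp1 _ _ H1) (IHp2 _ _ H2)).
  - intros [H | H]; [apply IHp1 in H | apply IHp2 in H];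
      revert H; apply near_mono; auto.
  - exact near_near.
  - exact near_near.
  - intros [x H]. apply IHp in H. revert H. apply near_mono. eauto.
Qed.

(** Needed for reflection, where environments are cut down to finite lists. *)
Lemma forces_fvs p r r' t :
  (forall i, In i (fvs p) -> r i = r' i) -> forces r p t -> forces r' p t.
Proof.
  assert (L : forall l r r' x, (forall i, In i (lower l) -> r i = r' i) ->
            forall i, In i l -> @scons name x r i = scons x r' i).
  { intros l q q' x H [|i] Hi; [reflexivity|]. apply H. unfold lower.
    apply in_flat_map. exists (S i). split; [exact Hi | now left]. }
  assert (Sy : forall (l : list nat) r r', (forall i, In i l -> r i = r' i) ->
            forall i, In i l -> r' i = r i :> name).
  { intros l q q' H i Hi. symmetry. auto. }
  revert r r' t. induction p; intros r r' t H; cbn in *.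
  - trivial.
  - rewrite <- !H by auto. trivial.
  - rewrite <- !H by auto. trivial.
  - intros [H1 H2]. split; [revert H1; apply IHp1 | revert H2; apply IHp2];
      intros i Hi; apply H, in_or_app; auto.
  - intros [H1 | H1]; [left; revert H1; apply IHp1 | right; revert H1; apply IHp2];
      intros i Hi; apply H, in_or_app; auto.
  - apply near_mono. intros s K H1. apply (IHp2 r r').
    + intros i Hi; apply H, in_or_app; auto.
    + apply K. revert H1. apply IHp1. intros i Hi. symmetry. apply H, in_or_app; auto.
  - apply near_mono. intros s K x. refine (IHp _ _ _ _ (K x)). now apply L.
  - intros [x K]. exists x. refine (IHp _ _ _ _ K). now apply L.
Qed.

Lemma forces_ext p r r' t : (forall i, r i = r' i) -> forces r p t <-> forces r' p t.
Proof. intro H. split; apply forces_fvs; intros; auto. Qed.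

Lemma forces_ren p f r t : forces r (ren f p) t <-> forces (fun i => r (f i)) p t.
Proof.
  assert (U : forall x r f i, @scons name x r (up f i) = scons x (fun i => r (f i)) i).
  { intros x q g [|i]; reflexivity. }
  revert f r t. induction p; intros f r t; cbn; try tauto.
  - now rewrite IHp1, IHp2.
  - now rewrite IHp1, IHp2.
  - split; apply near_mono; intros s K H; apply IHp2, K, IHp1, H.
  - split; apply near_mono; intros s K x; specialize (K x).
    + apply IHp in K. revert K. apply forces_ext. intro; now rewrite U.
    + apply IHp. revert K. apply forces_ext. intro; now rewrite U.
  - split; intros [x K]; exists x.
    + apply IHp in K. revert K. apply forces_ext. intro; now rewrite U.
    + apply IHp. revert K. apply forces_ext. intro; now rewrite U.
Qed.

Lemma forces_shift p x r t : forces (scons x r) (shift p) t <-> forces r p t.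
Proof. unfold shift. rewrite forces_ren. reflexivity. Qed.

Lemma forces_inst p i r t : forces r (inst i p) t <-> forces (scons (r i) r) p t.
Proof.
  unfold inst. rewrite forces_ren. apply forces_ext. now intros [|j].
Qed.

(** Only one pair x, y is exchanged, though possibly at many variables: the
    equality of infinitely many pairs of names would not persist to a
    neighbourhood, as the quantifiers and implications require. *)
Lemma forces_subst p x y r r' t :
  x ==[t] y -> (forall i, r i = r' i \/ (r i = x /\ r' i = y)) ->
  forces r p t <-> forces r' p t.
Proof.
  assert (L : forall r r' z, (forall i, r i = r' i \/ (r i = x /\ r' i = y)) ->
            forall i, @scons name z r i = scons z r' i \/
                      (scons z r i = x /\ scons z r' i = y)).
  { intros q q' z H [|i]; [now left | apply H]. }
  revert r r' t. induction p; intros r r' t E H.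
  - reflexivity.
  - cbn.
    assert (K : forall i, r i ==[t] r' i).
    { intro i. destruct (H i) as [-> | [-> ->]]; [reflexivity | exact E]. }
    now rewrite !K.
  - cbn.
    assert (K : forall i, r i ==[t] r' i).
    { intro i. destruct (H i) as [-> | [-> ->]]; [reflexivity | exact E]. }
    now rewrite !K.
  - cbn. now rewrite (IHp1 r r'), (IHp2 r r').
  - cbn. now rewrite (IHp1 r r'), (IHp2 r r').
  - apply eq_at_stable in E. cbn.
    split; intro K; refine (near_mono _ (near_and E K)); intros s [Es Ks] H1.
    + now apply (IHp2 r r'), Ks, (IHp1 r r').
    + now apply (IHp2 r r'), Ks, (IHp1 r r').
  - apply eq_at_stable in E. cbn.
    split; intro K; refine (near_mono _ (near_and E K)); intros s [Es Ks] z; specialize (Ks z).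
    + now apply (IHp (scons z r) (scons z r') s Es); [apply L|].
    + now apply (IHp (scons z r) (scons z r') s Es); [apply L|].
  - cbn. split; intros [z K]; exists z.
    + now apply (IHp (scons z r) (scons z r') t E); [apply L|].
    + now apply (IHp (scons z r) (scons z r') t E); [apply L|].
Qed.

Lemma forces_list G r t :
  (forall p, In p G -> forces r p t) -> near t (fun s => forall p, In p G -> forces r p s).
Proof.
  induction G as [|q G IH]; intro H.
  - apply near_all. contradiction.
  - refine (near_mono _ (near_and (@forces_stable q r t _) (IH _))).
    + intros s [H1 H2] p [<- | Hp]; auto.
    + apply H. now left.
    + intros p Hp. apply H. now right.
Qed.

Lemma soundness (Ax : fm -> Prop) :
  (forall p, Ax p -> forall r t, forces r p t) ->
  forall G p, prv Ax G p ->
  forall r t, (forall q, In q G -> forces r q t) -> forces r p t.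
Proof.
  intros HA G p D. induction D; intros e t HG; cbn in *.
  - now apply HA.
  - now apply HG.
  - destruct (IHD e t HG).
  - split; auto.
  - now apply (IHD e t HG).
  - now apply (IHD e t HG).
  - left; auto.
  - right; auto.
  - destruct (IHD1 e t HG) as [H | H]; [apply IHD2 | apply IHD3];
      intros c [<- | Hc]; auto.
  - refine (near_mono _ (forces_list HG)). intros s Hs Hp. apply IHD.
    intros c [<- | Hc]; auto.
  - exact (near_here (IHD1 e t HG) (IHD2 e t HG)).
  - refine (near_mono _ (forces_list HG)). intros s Hs x. apply IHD.
    intros c Hc. apply in_map_iff in Hc. destruct Hc as (c' & <- & Hc').
    apply forces_shift. auto.
  - apply forces_inst. apply (near_here (IHD e t HG)).
  - exists (e i). apply forces_inst. auto.
  - destruct (IHD1 e t HG) as [x Hx]. apply (@forces_shift q x e t). apply IHD2.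
    intros c [<- | Hc]; [exact Hx|].
    apply in_map_iff in Hc. destruct Hc as (c' & <- & Hc'). apply forces_shift. auto.
  - reflexivity.
  - apply forces_inst.
    apply (@forces_subst p (e i) (e j) (scons (e i) e) _ t); [now apply IHD1 | | apply forces_inst; auto].
    intros [|k]; [right | left]; auto.
Qed.

End Forcing.

Arguments Name {T} A elt deg.
Arguments elt {T} x _.
Arguments deg {T} x _ _.

Notation "x ==[ t ] y" := (eq_at t x y) (at level 70).
Notation "x \in[ t ] y" := (mem_at t x y) (at level 70).

(** * Denotations of formulas, and the axioms other than reflection *)

Section Denotation.
Variable T : space.
Implicit Types t s : T.
Implicit Types a b c : name T.
Implicit Types x y z : var.
Implicit Types r : nat -> name T.

(** In the environment r, the variable x stands for a when it occurs under d
    binders.  The first half says that x is a genuine variable: its index grows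
    with the depth. *)
Definition rep (d : nat) r (x : var) a : Prop :=
  (forall k, x (k + d) = k + x d) /\ r (x d) = a.

(** P is the meaning of p under d binders.  The tactic [den] computes P from p,
    one connective at a time; the lemmas [den_X] below replace the result for
    a defined notion X by a readable one, and are then used by [den]. *)
Definition Den (d : nat) r (p : fb) (P : T -> Prop) : Prop :=
  forall t, forces r (p d) t <-> P t.

(** r0 is r without its d innermost entries; the free variables of a whole
    formula, written [param i], are read in r0. *)
Definition under (d : nat) r r0 : Prop := forall i, r (d + i) = r0 i.

Lemma rep_bound d r b : rep (S d) (scons b r) (bound d) b.
Proof.
  unfold rep, bound. split; [intro k|]; replace (S d - S d) with 0 by lia; [lia | reflexivity].
Qed.

Lemma rep_lift d r x a b : rep d r x a -> rep (S d) (scons b r) x a.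
Proof.
  intros [H1 H2]. assert (E : x (S d) = S (x d)) by exact (H1 1). split.
  - intro k. replace (k + S d) with (S k + d) by lia. rewrite H1, E. lia.
  - now rewrite E.
Qed.

Lemma rep_param d r r0 i : under d r r0 -> rep d r (param i) (r0 i).
Proof. intro H. split; [intro k; unfold param; lia | apply H]. Qed.

Lemma under_lift d r r0 b : under d r r0 -> under (S d) (scons b r) r0.
Proof. intros H i. apply H. Qed.

Lemma under_refl r : under 0 r r.
Proof. intro i. reflexivity. Qed.

Lemma den_iff d r p (P Q : T -> Prop) :
  Den d r p P -> (forall t, P t <-> Q t) -> Den d r p Q.
Proof. intros H K t. rewrite <- (K t). apply H. Qed.

Lemma den_fal d r : Den d r bFal (fun _ => False).
Proof. intro t. reflexivity. Qed.

Lemma den_eq d r x y a b :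
  rep d r x a -> rep d r y b -> Den d r (bEq x y) (fun t => a ==[t] b).
Proof. intros [_ <-] [_ <-] t. reflexivity. Qed.

Lemma den_mem d r x y a b :
  rep d r x a -> rep d r y b -> Den d r (bMem x y) (fun t => a \in[t] b).
Proof. intros [_ <-] [_ <-] t. reflexivity. Qed.

Lemma den_and d r p q P Q :
  Den d r p P -> Den d r q Q -> Den d r (bAnd p q) (fun t => P t /\ Q t).
Proof. intros HP HQ t. cbn. now rewrite (HP t), (HQ t). Qed.

Lemma den_or d r p q P Q :
  Den d r p P -> Den d r q Q -> Den d r (bOr p q) (fun t => P t \/ Q t).
Proof. intros HP HQ t. cbn. now rewrite (HP t), (HQ t). Qed.

Lemma den_imp d r p q P Q :
  Den d r p P -> Den d r q Q ->
  Den d r (bImp p q) (fun t => near t (fun s => P s -> Q s)).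
Proof.
  intros HP HQ t. cbn. split; apply near_mono; intros s H K; apply HQ, H, HP, K.
Qed.

Lemma den_iff_fm d r p q P Q :
  Den d r p P -> Den d r q Q ->
  Den d r (bIff p q) (fun t => near t (fun s => P s <-> Q s)).
Proof.
  intros HP HQ t. unfold bIff.
  rewrite (den_and (den_imp HP HQ) (den_imp HQ HP) t). split.
  - intros [H K]. refine (near_mono _ (near_and H K)). tauto.
  - intro H. split; revert H; apply near_mono; tauto.
Qed.

Lemma den_all d r f P :
  (forall a, Den (S d) (scons a r) (f (bound d)) (P a)) ->
  Den d r (bAll f) (fun t => near t (fun s => forall a, P a s)).
Proof.
  intros H t. cbn. split; apply near_mono; intros s K a; apply H, K.
Qed.

(** The neighbourhoods of the quantifier and of the implication merge into
    one. *)
Lemma den_all_in d r f g P Q :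
  (forall a, Den (S d) (scons a r) (f (bound d)) (P a)) ->
  (forall a, Den (S d) (scons a r) (g (bound d)) (Q a)) ->
  Den d r (bAll (fun x => bImp (f x) (g x)))
    (fun t => near t (fun s => forall a, P a s -> Q a s)).
Proof.
  intros HP HQ t. cbn. split.
  - apply near_mono. intros s K a Ha. apply HQ, (near_here (K a)), HP, Ha.
  - intro K. refine (near_mono _ (near_near K)). intros s Ks a.
    refine (near_mono _ Ks). intros u Ku Ha. apply HQ, Ku, HP, Ha.
Qed.

Lemma den_all_iff d r f g P Q :
  (forall a, Den (S d) (scons a r) (f (bound d)) (P a)) ->
  (forall a, Den (S d) (scons a r) (g (bound d)) (Q a)) ->
  Den d r (bAll (fun x => bIff (f x) (g x)))
    (fun t => near t (fun s => forall a, P a s <-> Q a s)).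
Proof.
  intros HP HQ t.
  rewrite (den_all (f := fun x => bIff (f x) (g x)) (fun a => den_iff_fm (HP a) (HQ a)) t).
  split.
  - apply near_mono. intros s K a. exact (near_here (K a)).
  - intro K. refine (near_mono _ (near_near K)). intros s Ks a.
    refine (near_mono _ Ks). auto.
Qed.

Lemma den_ex d r f P :
  (forall a, Den (S d) (scons a r) (f (bound d)) (P a)) ->
  Den d r (bEx f) (fun t => exists a, P a t).
Proof. intros H t. cbn. split; intros [a K]; exists a; apply H, K. Qed.

Lemma den_emb1 d r r0 p x a :
  under d r r0 -> rep d r x a -> Den d r (emb1 p x) (forces (scons a r0) p).
Proof.
  intros H [_ Hx] t. unfold emb1, emb. rewrite forces_ren. apply forces_ext.
  intros [|i]; [exact Hx | apply H].
Qed.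

End Denotation.

Ltac den_rep :=
  first [ eassumption | eapply rep_bound | eapply rep_param; den_under
        | eapply rep_lift; den_rep ]
with den_under :=
  first [ eassumption | eapply under_refl | eapply under_lift; den_under ].

Ltac den_atom := fail.

Ltac den :=
  lazymatch goal with
  | |- forall _, _ => intro; den
  | |- rep _ _ _ _ => den_rep
  | |- under _ _ _ => den_under
  | |- Den _ _ bFal _ => eapply den_fal
  | |- Den _ _ (bEq _ _) _ => eapply den_eq; den
  | |- Den _ _ (bMem _ _) _ => eapply den_mem; den
  | |- Den _ _ (bAnd _ _) _ => eapply den_and; den
  | |- Den _ _ (bOr _ _) _ => eapply den_or; den
  | |- Den _ _ (bImp _ _) _ => eapply den_imp; den
  | |- Den _ _ (bNot _) _ => eapply den_imp; den
  | |- Den _ _ (bIff _ _) _ => eapply den_iff_fm; den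
  | |- Den _ _ (bAll (fun x => bIff (@?f x) (@?g x))) _ =>
      eapply (@den_all_iff _ _ _ f g); den
  | |- Den _ _ (bAll (fun x => bImp (@?f x) (@?g x))) _ =>
      eapply (@den_all_in _ _ _ f g); den
  | |- Den _ _ (bAll (fun x => bNot (@?f x))) _ =>
      eapply (@den_all_in _ _ _ f (fun _ => bFal)); den
  | |- Den _ _ (bAll _) _ => eapply den_all; den
  | |- Den _ _ (bEx _) _ => eapply den_ex; den
  | |- Den _ _ (emb1 _ _) _ => eapply den_emb1; den
  | |- Den _ _ ((fun _ => _) _) _ => cbv beta; den
  | |- Den _ _ _ _ => first [eassumption | den_atom; den]
  | |- _ => idtac
  end.

Section FirstSets.
Variable T : space.
Implicit Types t s : T.
Implicit Types a b c : name T.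
Implicit Types x y z : var.
Implicit Types r : nat -> name T.

Definition valid (p : fb) : Prop := forall r t, forces r (formula p) t.

Lemma valid_den p (P : (nat -> name T) -> T -> Prop) :
  (forall r, Den 0 r p (P r)) -> (forall r t, P r t) -> valid p.
Proof. intros H K r t. apply H, K. Qed.

Lemma valid_ext : valid ax_ext.
Proof.
  eapply valid_den; [intro r; unfold ax_ext; den | intros r t; cbv beta].
  apply near_all; intros s a. apply near_all; intros u b. apply eq_at_ext.
Qed.

(** How a term given by its graph is recognized as a concrete name. *)
Lemma eq_at_char t a b (P : name T -> T -> Prop) :
  (forall s c, c \in[s] b <-> P c s) ->
  near t (fun s => forall c, c \in[s] a <-> P c s) <-> a ==[t] b.
Proof.
  intro H. rewrite eq_at_ext. split; apply near_mono; intros s K c; rewrite K, H; reflexivity.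
Qed.

Definition empty_name : name T := Name Empty_set (fun i => match i with end) (fun _ _ => True).

Definition succ_name a : name T :=
  Name (option (idx a))
    (fun i => match i with None => a | Some j => elt a j end)
    (fun i => match i with None => fun _ => True | Some j => deg a j end).

Definition upair_name a b : name T :=
  Name bool (fun i => if i then a else b) (fun _ _ => True).

Lemma mem_empty t c : c \in[t] empty_name <-> False.
Proof. split; [intros [[] _] | contradiction]. Qed.

Lemma mem_succ t a c : c \in[t] succ_name a <-> c \in[t] a \/ c ==[t] a.
Proof.
  split.
  - intros [[j|] [H E]]; [left; now exists j | now right].
  - intros [[j [H E]] | E].
    + now exists (Some j).
    + exists None. split; [now apply near_all | exact E].
Qed.

Lemma mem_upair t a b c : c \in[t] upair_name a b <-> c ==[t] a \/ c ==[t] b.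
Proof.
  split.
  - intros [[|] [_ E]]; [now left | now right].
  - intros [E | E]; [exists true | exists false]; (split; [now apply near_all | exact E]).
Qed.

Lemma mem_total t (A : Type) (f : A -> name T) c :
  c \in[t] Name A f (fun _ _ => True) <-> exists i, c ==[t] f i.
Proof.
  split.
  - intros [i [_ E]]. now exists i.
  - intros [i E]. exists i. split; [now apply near_all | exact E].
Qed.

#[export] Instance succ_name_proper t : Proper (eq_at t ==> eq_at t) succ_name.
Proof.
  intros a b E. apply eq_at_ext. refine (near_mono _ (eq_at_stable E)).
  intros s Es c. now rewrite !mem_succ, Es.
Qed.

#[export] Instance upair_name_proper t :
  Proper (eq_at t ==> eq_at t ==> eq_at t) upair_name.
Proof.
  intros a a' E b b' E'. apply eq_at_ext.
  refine (near_mono _ (near_and (eq_at_stable E) (eq_at_stable E'))).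
  intros s [Es Es'] c. now rewrite !mem_upair, Es, Es'.
Qed.

Fixpoint num (n : nat) : name T :=
  match n with 0 => empty_name | S k => succ_name (num k) end.

Definition omega_name : name T := Name nat num (fun _ _ => True).

Lemma den_empty d r x a : rep d r x a -> Den d r (t_empty x) (fun t => a ==[t] num 0).
Proof.
  intro Hx. eapply den_iff; [unfold t_empty; den | intro t; cbv beta].
  rewrite eq_at_ext. split; apply near_mono; intros s H c; [|specialize (H c)];
    rewrite mem_empty in *; firstorder.
Qed.

Lemma den_succ d r x y a b :
  rep d r x a -> rep d r y b -> Den d r (t_succ x y) (fun t => b ==[t] succ_name a).
Proof.
  intros Hx Hy. eapply den_iff; [unfold t_succ; den | intro t; cbv beta].
  apply eq_at_char. intros s c. apply mem_succ.
Qed.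

End FirstSets.

Ltac den_atom ::=
  lazymatch goal with
  | |- Den _ _ (t_empty _) _ => eapply den_empty
  | |- Den _ _ (t_succ _ _) _ => eapply den_succ
  end.

Section SetAxioms.
Variable T : space.
Implicit Types t s : T.
Implicit Types a b c : name T.
Implicit Types x y z : var.
Implicit Types r : nat -> name T.

Lemma den_inductive d r x a : rep d r x a ->
  Den d r (inductive x) (fun t => num T 0 \in[t] a /\
    near t (fun s => forall b, b \in[s] a -> succ_name b \in[s] a)).
Proof.
  intro Hx. eapply den_iff; [unfold inductive; den | intro t; cbv beta].
  split; intros [H K]; split.
  - destruct H as (b & E & H'). now rewrite <- E.
  - revert K. apply near_mono. intros s K b Hb. destruct (K b Hb) as (c & E & H').
    now rewrite <- E.
  - now exists (num T 0).
  - revert K. apply near_mono. intros s K b Hb. exists (succ_name b). split; auto. reflexivity.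
Qed.

Lemma mem_omega t c : c \in[t] omega_name T <-> exists n, c ==[t] num T n.
Proof. apply mem_total. Qed.

Lemma num_inductive t a n :
  num T 0 \in[t] a -> near t (fun s => forall b, b \in[s] a -> succ_name b \in[s] a) ->
  num T n \in[t] a.
Proof.
  intros H K. induction n; [exact H | exact (near_here K _ IHn)].
Qed.

Lemma omega_inductive t : num T 0 \in[t] omega_name T /\
    near t (fun s => forall b, b \in[s] omega_name T -> succ_name b \in[s] omega_name T).
Proof.
  split.
  - apply mem_omega. exists 0. reflexivity.
  - apply near_all. intros s b Hb. apply mem_omega in Hb. destruct Hb as [n E].
    apply mem_omega. exists (S n). now rewrite E.
Qed.

(** The natural numbers of the model are the standard ones: the name whose
    members are all the numerals is inductive, and every inductive set contains
    each numeral. *)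
Lemma den_nat d r x a : rep d r x a ->
  Den d r (Nat x) (fun t => exists n, a ==[t] num T n).
Proof.
  intro Hx. eapply den_iff; [unfold Nat; eapply den_all_in; intro b; [eapply den_inductive|]; den | intro t; cbv beta].
  split.
  - intro H. apply mem_omega, (near_here H), omega_inductive.
  - intros [n E]. refine (near_mono _ (eq_at_stable E)). intros s Es w [H0 HS].
    rewrite Es. now apply num_inductive.
Qed.

Lemma valid_empty : valid T ax_empty.
Proof.
  eapply valid_den; [intro r; unfold ax_empty; den | intros r t; cbv beta].
  exists (num T 0). reflexivity.
Qed.

Lemma valid_pair : valid T ax_pair.
Proof.
  eapply valid_den; [intro r; unfold ax_pair; den | intros r t; cbv beta].
  apply near_all; intros s a. apply near_all; intros u b.
  exists (upair_name a b). apply near_all. intros v c. apply mem_upair.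
Qed.

Definition union_name a : name T :=
  Name {i : idx a & idx (elt a i)} (fun p => elt (elt a (projT1 p)) (projT2 p))
    (fun p s => near s (deg a (projT1 p)) /\ near s (deg (elt a (projT1 p)) (projT2 p))).

Lemma mem_union t a c : c \in[t] union_name a <-> exists b, b \in[t] a /\ c \in[t] b.
Proof.
  split.
  - intros [[i j] [H E]]. cbn in *. apply near_here in H as [Hi Hj].
    exists (elt a i). split; [now apply elt_mem | now exists j].
  - intros (b & (i & Hi & Eb) & Hc). rewrite Eb in Hc. destruct Hc as (j & Hj & E).
    exists (existT _ i j). split; [|exact E]. apply near_and; now apply near_near.
Qed.

Lemma valid_union : valid T ax_union.
Proof.
  eapply valid_den; [intro r; unfold ax_union; den | intros r t; cbv beta].
  apply near_all; intros s a.
  exists (union_name a). apply near_all. intros v c. apply mem_union.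
Qed.

Lemma valid_infinity : valid T ax_infinity.
Proof.
  eapply valid_den; [intro r; unfold ax_infinity; eapply den_ex; intro; eapply den_inductive; den | intros r t; cbv beta].
  exists (omega_name T). apply omega_inductive.
Qed.

Definition sep_name a (P : name T -> T -> Prop) : name T :=
  Name (idx a) (elt a) (fun i s => near s (deg a i) /\ P (elt a i) s).

(** The hypotheses on P say that it is open and respects equality, as the
    forcing relation of a formula does. *)
Lemma mem_sep t a P c :
  (forall s b, P b s -> near s (P b)) ->
  (forall s b b', b ==[s] b' -> P b s -> P b' s) ->
  c \in[t] sep_name a P <-> c \in[t] a /\ P c t.
Proof.
  intros HS HP. split.
  - intros (i & H & E). cbn in *. apply near_here in H as [Hi H].
    split; [now exists i | exact (HP _ _ _ (eq_at_sym E) H)].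
  - intros [(i & Hi & E) H]. exists i. split; [|exact E]. cbn.
    apply near_and; [now apply near_near | apply HS; exact (HP _ _ _ E H)].
Qed.

(** A subset of a is determined by the set of points at which it contains each
    member of a. *)
Definition power_name a : name T :=
  Name (idx a -> T -> Prop)
    (fun D => Name (idx a) (elt a) (fun i s => near s (deg a i) /\ D i s))
    (fun _ _ => True).

Lemma valid_power : valid T ax_power.
Proof.
  eapply valid_den; [intro r; unfold ax_power, subset; den | intros r t; cbv beta].
  apply near_all; intros s a. exists (power_name a). apply near_all. intros u b.
  unfold power_name. rewrite mem_total. split.
  - intros (D & E). refine (near_mono _ (eq_at_stable E)). intros v Ev c Hc.
    rewrite Ev in Hc. destruct Hc as (i & Hi & Ec). apply near_here in Hi as [Hi _].
    now exists i.
  - intro H. exists (fun i v => elt a i \in[v] b). apply eq_at_ext.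
    revert H. apply near_mono. intros v H c. split.
    + intro Hc. destruct (H c Hc) as (i & Hi & E). exists i. split; [|exact E].
      rewrite E in Hc. apply near_and; [now apply near_near | now apply mem_at_stable].
    + intros (i & Hi & E). rewrite E. exact (proj2 (near_here Hi)).
Qed.

Lemma forces_head p a b r t :
  a ==[t] b -> forces (scons a r) p t -> forces (scons b r) p t.
Proof.
  intro E. apply (@forces_subst T p a b (scons a r) (scons b r) t E). intros [|i]; auto.
Qed.

Lemma valid_separation p : valid T (ax_separation p).
Proof.
  eapply valid_den; [intro r; unfold ax_separation; den | intros r t; cbv beta].
  apply near_all; intros s a. exists (sep_name a (fun b => forces (scons b r) p)).
  apply near_all. intros u b. apply mem_sep.
  - intros v c. apply forces_stable.
  - intros v c c'. apply forces_head.
Qed.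

Lemma valid_induction p : valid T (ax_induction p).
Proof.
  eapply valid_den; [intro r; unfold ax_induction; den | intros r t; cbv beta].
  apply near_all; intros s H. refine (near_mono _ (near_near H)). clear s H.
  intros s H a. revert s H. induction a as [A f IH e]. intros s H.
  refine (near_here H _ _). refine (near_mono _ (near_near H)). intros u Hu b (i & _ & E).
  apply (forces_head (eq_at_sym E)). now apply IH.
Qed.

End SetAxioms.

(** * Reflection *)

Section Reflection.
Variable T : space.
Implicit Types t s : T.
Implicit Types a b c : name T.
Implicit Types x y z : var.
Implicit Types r : nat -> name T.

(** Forcing of the relativized formula: the quantifiers range over the members
    of c. *)
Fixpoint forces_in c r (p : fm) t : Prop :=
  match p with
  | FFal => False
  | FEq i j => r i ==[t] r j
  | FMem i j => r i \in[t] r j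
  | FAnd p q => forces_in c r p t /\ forces_in c r q t
  | FOr p q => forces_in c r p t \/ forces_in c r q t
  | FImp p q => near t (fun s => forces_in c r p s -> forces_in c r q s)
  | FAll p => near t (fun s => forall a, a \in[s] c -> forces_in c (scons a r) p s)
  | FEx p => exists a, a \in[t] c /\ forces_in c (scons a r) p t
  end.

Lemma forces_in_ext c p r r' t :
  (forall i, r i = r' i) -> forces_in c r p t <-> forces_in c r' p t.
Proof.
  revert r r' t. induction p; intros r r' t E; cbn; rewrite ?E; try reflexivity.
  - now rewrite (IHp1 r r'), (IHp2 r r').
  - now rewrite (IHp1 r r'), (IHp2 r r').
  - split; apply near_mono; intros s K H;
      apply (IHp2 r r' s E), K, (IHp1 r r' s E), H.
  - assert (L : forall a i, scons a r i = scons a r' i) by (intros a [|i]; cbn; auto).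
    split; apply near_mono; intros s K a Ha; apply (IHp _ _ s (L a)), K, Ha.
  - assert (L : forall a i, scons a r i = scons a r' i) by (intros a [|i]; cbn; auto).
    split; intros (a & Ha & K); exists a; (split; [exact Ha | apply (IHp _ _ t (L a)), K]).
Qed.

Lemma forces_rel p f k r t :
  forces r (rel k (ren f p)) t <-> forces_in (r k) (fun i => r (f i)) p t.
Proof.
  assert (U : forall r f a i, scons a (fun i => r (f i)) i = scons a r (up f i)).
  { intros q g a [|i]; reflexivity. }
  revert f k r t. induction p; intros f k r t; cbn; try reflexivity.
  - now rewrite IHp1, IHp2.
  - now rewrite IHp1, IHp2.
  - split; apply near_mono; intros s K H; apply IHp2, K, IHp1, H.
  - split; intro K.
    + revert K. apply near_mono. intros s K a Ha. specialize (near_here (K a) Ha) as Ka.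
      apply IHp in Ka. revert Ka. apply forces_in_ext. apply U.
    + refine (near_mono _ (near_near K)). intros s Ks a. refine (near_mono _ Ks).
      intros u Ku Ha. apply IHp. generalize (Ku a Ha). apply forces_in_ext. intro i. symmetry. apply U.
  - split; intros (a & Ha & K); exists a; (split; [exact Ha|]).
    + apply IHp in K. revert K. apply forces_in_ext. apply U.
    + apply IHp. revert K. apply forces_in_ext. intro i. symmetry. apply U.
Qed.

Lemma den_rel d r r0 p x y a c : under d r r0 -> rep d r x a -> rep d r y c ->
  Den d r (bRel y (emb1 p x)) (forces_in c (scons a r0) p).
Proof.
  intros H [_ Hx] [_ <-] t. unfold bRel, emb1, emb. rewrite forces_rel.
  apply forces_in_ext. intros [|i]; [exact Hx | apply H].
Qed.

(** Families are small, so each of them is the list of the members of a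
    name. *)
Definition family : Type := {A : Type & A -> name T}.

Definition listed (F : family) a : Prop := exists i, projT2 F i = a.

Definition env (l : list (name T)) : nat -> name T := fun i => nth i l (empty_name T).

Definition truth (v : bool) (P : Prop) : Prop := if v then P else ~ P.

(** A name that makes p true ([v = true]) or false ([v = false]) at t, if there
    is one; the free variables of p other than 0 are read in the list l.  The
    false instances are what a universal formula needs. *)
Definition witness t (p : fm) (l : list (name T)) (v : bool) : name T :=
  epsilon (inhabits (empty_name T)) (fun a => truth v (forces (scons a (env l)) p t)).

Definition next (F : family) : family :=
  let (A, f) := F in
  existT _ (A + {i : A & idx (f i)} + T * fm * list A * bool)%type
    (fun k => match k with
     | inl (inl i) => f i
     | inl (inr (existT _ i j)) => elt (f i) j
     | inr (t, p, l, v) => witness t p (map f l) v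
     end).

Fixpoint stage (F : family) (n : nat) : family :=
  match n with 0 => F | S k => next (stage F k) end.

Definition closure (F : family) : family :=
  existT _ {n : nat & projT1 (stage F n)} (fun k => projT2 (stage F (projT1 k)) (projT2 k)).

Lemma listed_next F a : listed F a -> listed (next F) a.
Proof. destruct F as [A f]. intros [i E]. now exists (inl (inl i)). Qed.

Lemma next_elt F a i : listed F a -> listed (next F) (elt a i).
Proof.
  destruct F as [A f]. intros [k <-]. now exists (inl (inr (existT _ k i))).
Qed.

Lemma next_witness F t p l v :
  (forall a, In a l -> listed F a) -> listed (next F) (witness t p l v).
Proof.
  destruct F as [A f]. intro H.
  assert (E : exists l', map f l' = l).
  { induction l as [|a l IH]; [now exists []|].
    destruct (H a) as [i Hi]; [now left|].
    destruct IH as [l' Hl]; [intros b Hb; apply H; now right|].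
    exists (i :: l'). cbn. now rewrite <- Hi, <- Hl. }
  destruct E as [l' <-]. now exists (inr (t, p, l', v)).
Qed.

Lemma listed_stage F n m a : n <= m -> listed (stage F n) a -> listed (stage F m) a.
Proof. intro H. induction H; [trivial | intro K; now apply listed_next, IHle]. Qed.

Lemma listed_closure F a : listed (closure F) a <-> exists n, listed (stage F n) a.
Proof.
  split.
  - intros [[n i] E]. exists n. now exists i.
  - intros [n [i E]]. now exists (existT _ n i).
Qed.

Lemma closure_elt F a i : listed (closure F) a -> listed (closure F) (elt a i).
Proof.
  rewrite !listed_closure. intros [n H]. exists (S n). now apply next_elt.
Qed.

Lemma closure_witness F t p l v :
  (forall a, In a l -> listed (closure F) a) -> listed (closure F) (witness t p l v).
Proof.
  intro H. assert (E : exists n, forall a, In a l -> listed (stage F n) a).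
  { induction l as [|a l IH]; [exists 0; contradiction|].
    destruct IH as [n Hn]; [intros b Hb; apply H; now right|].
    destruct (proj1 (listed_closure F a)) as [m Hm]; [apply H; now left|].
    exists (max n m). intros b [<- | Hb].
    - apply (listed_stage (n := m)); [lia | exact Hm].
    - apply (listed_stage (n := n)); [lia | auto]. }
  destruct E as [n Hn]. apply listed_closure. exists (S n). now apply next_witness.
Qed.

(** Every name can be replaced by a listed one, as far as the truth of one
    formula at one point is concerned.  The environment r is infinite, but only
    the variables of p matter, and the finitely many names they denote appear
    together at some stage. *)
Lemma closure_closed F t p r v a :
  (forall i, listed (closure F) (r i)) -> truth v (forces (scons a r) p t) ->
  exists b, listed (closure F) b /\ truth v (forces (scons b r) p t).
Proof.
  intros Hr Ha.
  (* The list has to reach every free variable of p; longer does no harm. *)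
  set (l := map r (seq 0 (S (list_max (fvs p))))).
  assert (El : forall b, forces (scons b r) p t <-> forces (scons b (env l)) p t).
  { intro b.
    assert (L : forall i, In i (fvs p) -> scons b r i = scons b (env l) i).
    { intros [|i] Hi; [reflexivity|]. change (r i = nth i l (empty_name T)). unfold l.
      assert (S i <= list_max (fvs p)).
      { pose proof (proj1 (list_max_le (fvs p) _) (le_n _)) as M.
        rewrite Forall_forall in M. now apply M. }
      rewrite (nth_indep _ _ (r 0)) by (rewrite length_map, length_seq; lia).
      rewrite map_nth, seq_nth; [reflexivity | lia]. }
    split; apply forces_fvs; intros i Hi; [|symmetry]; auto. }
  assert (Et : forall b, truth v (forces (scons b r) p t) <->
                         truth v (forces (scons b (env l)) p t)).
  { intro b. specialize (El b). destruct v; cbn; tauto. }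
  exists (witness t p l v). split.
  - apply closure_witness. intros b Hb. apply in_map_iff in Hb.
    destruct Hb as (i & <- & _). apply Hr.
  - apply Et. unfold witness.
    apply (epsilon_spec _ (fun a => truth v (forces (scons a (env l)) p t))).
    exists a. now apply Et.
Qed.

Definition family_name (F : family) : name T :=
  Name (projT1 F) (projT2 F) (fun _ _ => True).

Lemma mem_family F t c : c \in[t] family_name F <-> exists a, listed F a /\ c ==[t] a.
Proof.
  unfold family_name. rewrite mem_total. split.
  - intros [i E]. exists (projT2 F i). split; [now exists i | exact E].
  - intros (a & [i <-] & E). now exists i.
Qed.

(** Relativized forcing is forcing of another formula, so it inherits
    substitutivity. *)
Lemma forces_in_head c p a b r t :
  a ==[t] b -> forces_in c (scons a r) p t <-> forces_in c (scons b r) p t.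
Proof.
  intro E.
  rewrite <- (forces_rel p S 0 (scons c (scons a r)) t).
  rewrite <- (forces_rel p S 0 (scons c (scons b r)) t).
  apply (@forces_subst T _ a b _ _ t E). intros [|[|i]]; cbn; auto.
Qed.

(** By induction on p: an existential witness may be taken from the family, and
    a counterexample to a universal formula at a point as well.  Witnesses at
    single points suffice since an existential formula is evaluated at one
    point. *)
Lemma forces_reflect F p r t : (forall i, listed (closure F) (r i)) ->
  forces r p t <-> forces_in (family_name (closure F)) r p t.
Proof.
  assert (L : forall a r, listed (closure F) a -> (forall i, listed (closure F) (r i)) ->
            forall i, listed (closure F) (scons a r i)).
  { intros a q Ha Hq [|i]; cbn; auto. }
  revert r t. induction p; intros r t Hr; cbn; try reflexivity.
  - now rewrite IHp1, IHp2.
  - now rewrite IHp1, IHp2.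
  - split; apply near_mono; intros s K H; apply IHp2, K, IHp1; auto.
  - split; apply near_mono; intros s K a.
    + intro Ha. apply mem_family in Ha. destruct Ha as (b & Hb & E).
      apply (forces_in_head _ _ _ E), IHp; auto.
    + apply NNPP. intro N. destruct (@closure_closed F s p r false a Hr N) as (b & Hb & Nb).
      apply Nb, IHp; auto. apply K, mem_family. exists b. split; [exact Hb | reflexivity].
  - split.
    + intros [a Ha]. destruct (@closure_closed F t p r true a Hr Ha) as (b & Hb & Kb).
      exists b. split; [|apply IHp; auto].
      apply mem_family. exists b. split; [exact Hb | reflexivity].
    + intros (a & Ha & K). apply mem_family in Ha. destruct Ha as (b & Hb & E).
      exists b. apply IHp; auto. now apply (forces_in_head _ _ _ E).
Qed.

Lemma den_params d r r0 y c l : under d r r0 -> rep d r y c ->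
  Den d r (bConj (map (fun i => bMem (param i) y) l))
    (fun t => forall i, In i l -> r0 i \in[t] c).
Proof.
  intros Hb Hy. induction l as [|i l IH].
  - eapply den_iff; [unfold bConj, fold_right, map; den | intro t; cbv beta].
    split; [contradiction | intros _; now apply near_all].
  - eapply den_iff; [cbn; eapply den_and; [den | exact IH] | intro t; cbv beta].
    split.
    + intros [H K] j [<- | Hj]; auto.
    + intro H. split; [apply H; now left | intros j Hj; apply H; now right].
Qed.

Lemma valid_reflection p : valid T (ax_reflection p).
Proof.
  eapply valid_den.
  - intro r. unfold ax_reflection.
    eapply den_all; intro. eapply den_ex; intro. eapply den_and; [unfold transitive; den|].
    eapply den_and; [den|]. eapply den_and; [eapply den_params; den|].
    eapply (@den_all_in _ _ _ (fun x => bMem x (bound 1))); intro; [den|].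
    eapply den_iff_fm; [den | eapply den_rel; den].
  - intros r t. cbv beta. apply near_all. intros s a.
    (* The family starts with z and all the values of the parameters. *)
    set (F := existT (fun A => A -> name T) (option nat)
                (fun k => match k with None => a | Some i => r i end)).
    exists (family_name (closure F)).
    assert (HF : forall b, listed F b -> listed (closure F) b).
    { intros b Hb. apply listed_closure. now exists 0. }
    assert (Ha : listed (closure F) a) by (apply HF; now exists None).
    assert (Hr : forall i, listed (closure F) (r i)) by (intro i; apply HF; now exists (Some i)).
    assert (HM : forall u b, listed (closure F) b -> b \in[u] family_name (closure F)).
    { intros u b Hb. apply mem_family. exists b. split; [exact Hb | reflexivity]. }
    split; [|split; [|split]]; auto.
    + apply near_all. intros u b Hb. refine (near_mono _ (mem_at_stable Hb)).
      intros v Hv c Hc. apply mem_family in Hv. destruct Hv as (b' & Hb' & E).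
      rewrite E in Hc. destruct Hc as (i & _ & Ec). rewrite Ec.
      apply HM. now apply closure_elt.
    + apply near_all. intros u b Hb. refine (near_mono _ (mem_at_stable Hb)).
      intros v Hv. apply mem_family in Hv. destruct Hv as (b' & Hb' & E).
      rewrite (forces_in_head _ _ _ E). rewrite <- forces_reflect.
      * split; apply forces_head; [exact E | now symmetry].
      * intros [|i]; cbn; auto.
Qed.

Lemma forces_IZFRef p r t : IZFRef p -> forces r p t.
Proof.
  intros []; revert r t.
  - apply valid_ext.
  - apply valid_empty.
  - apply valid_pair.
  - apply valid_union.
  - apply valid_infinity.
  - apply valid_power.
  - apply valid_induction.
  - apply valid_separation.
  - apply valid_reflection.
Qed.

Theorem iprovable_forced p r t : iprovable IZFRef p -> forces r p t.
Proof.
  intro H. apply (soundness (fun q Hq e s => forces_IZFRef e s Hq) H). contradiction.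
Qed.

End Reflection.

(** * Natural numbers, pairs and functions in the model *)

Section Arithmetic.
Variable T : space.
Implicit Types t s : T.
Implicit Types a b c f p q : name T.
Implicit Types x y z : var.
Implicit Types r : nat -> name T.
Notation num := (num T).

Lemma mem_num t c n : c \in[t] num n <-> exists i, i < n /\ c ==[t] num i.
Proof.
  induction n as [|n IH]; cbn.
  - rewrite mem_empty. split; [contradiction | intros (i & H & _); lia].
  - rewrite mem_succ, IH. split.
    + intros [(i & H & E) | E]; [exists i | exists n]; split; auto; lia.
    + intros (i & H & E). destruct (Nat.eq_dec i n) as [->|]; [now right|].
      left. exists i. split; [lia | exact E].
Qed.

Lemma num_irrefl t n : ~ num n \in[t] num n.
Proof.
  induction n as [n IH] using lt_wf_ind. intro H.
  destruct (proj1 (mem_num _ _ _) H) as (i & Hi & E). apply (IH i Hi).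
  rewrite <- E at 2. apply mem_num. exists i. split; [exact Hi | reflexivity].
Qed.

Lemma num_inj t i j : num i ==[t] num j <-> i = j.
Proof.
  split; [|intros ->; reflexivity]. intro E.
  assert (L : forall k l, num k ==[t] num l -> ~ k < l).
  { intros k l E' H. apply (@num_irrefl t k). rewrite E' at 2. apply mem_num.
    exists k. split; [exact H | reflexivity]. }
  assert (~ i < j) by auto. assert (~ j < i) by (apply L; now symmetry). lia.
Qed.

Lemma num_mem t i j : num i \in[t] num j <-> i < j.
Proof.
  rewrite mem_num. split.
  - intros (k & H & E). apply num_inj in E. lia.
  - intro H. exists i. split; [exact H | reflexivity].
Qed.

Lemma den_pnat d r x a : rep d r x a ->
  Den d r (PNat x) (fun t => exists n, a ==[t] num (S n)).
Proof.
  intro Hx. eapply den_iff; [unfold PNat; eapply den_and; [eapply den_nat|]; den | intro t; cbv beta].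
  split.
  - intros [[[|n] E] H]; [destruct (near_here H E) | now exists n].
  - intros [n E]. split; [now exists (S n)|].
    refine (near_mono _ (eq_at_stable E)). intros s Es. rewrite Es, num_inj. lia.
Qed.

Lemma upair_eq t a b c d :
  upair_name a b ==[t] upair_name c d <-> (a ==[t] c /\ b ==[t] d) \/ (a ==[t] d /\ b ==[t] c).
Proof.
  split.
  - intro E. assert (H : forall u, (u ==[t] a \/ u ==[t] b) <-> (u ==[t] c \/ u ==[t] d)).
    { intro u. rewrite <- !mem_upair, E. reflexivity. }
    assert (Ha := proj1 (H a) (or_introl (reflexivity a))).
    assert (Hb := proj1 (H b) (or_intror (reflexivity b))).
    assert (Hc := proj2 (H c) (or_introl (reflexivity c))).
    assert (Hd := proj2 (H d) (or_intror (reflexivity d))).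
    destruct Ha as [Ha | Ha]; destruct Hb as [Hb | Hb];
      destruct Hc as [Hc | Hc]; destruct Hd as [Hd | Hd];
      try (left; split; assumption); try (right; split; assumption).
    all: try (left; split; [assumption | now symmetry]).
    all: try (right; split; [assumption | now symmetry]).
    all: try (left; split; [now symmetry | assumption]).
    all: try (right; split; [now symmetry | assumption]).
  - intros [[-> ->] | [-> ->]]; [reflexivity|].
    apply eq_at_ext, near_all. intros s u. rewrite !mem_upair. tauto.
Qed.

Definition pair_name a b : name T := upair_name (upair_name a a) (upair_name a b).

#[export] Instance pair_name_proper t :
  Proper (eq_at t ==> eq_at t ==> eq_at t) pair_name.
Proof. intros a a' E b b' E'. unfold pair_name. now rewrite E, E'. Qed.

(** Kuratowski's argument applies because a disjunction is forced at a point
    only if one of its sides is. *)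
Lemma pair_eq t a b c d :
  pair_name a b ==[t] pair_name c d <-> a ==[t] c /\ b ==[t] d.
Proof.
  split.
  - intro E. apply upair_eq in E. rewrite !upair_eq in E.
    assert (Ha : a ==[t] c) by tauto. split; [exact Ha|].
    assert (H : b ==[t] d \/ (a ==[t] d /\ b ==[t] c)) by tauto.
    destruct H as [H | [H1 H2]]; [exact H|]. now rewrite H2, <- Ha.
  - now intros [-> ->].
Qed.

Lemma den_upair d r x y z a b c : rep d r x a -> rep d r y b -> rep d r z c ->
  Den d r (t_upair x y z) (fun t => c ==[t] upair_name a b).
Proof.
  intros Hx Hy Hz. eapply den_iff; [unfold t_upair; den | intro t; cbv beta].
  apply eq_at_char. intros s u. apply mem_upair.
Qed.

Lemma den_pair d r x y z a b c : rep d r x a -> rep d r y b -> rep d r z c ->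
  Den d r (t_pair x y z) (fun t => c ==[t] pair_name a b).
Proof.
  intros Hx Hy Hz. eapply den_iff.
  - unfold t_pair. eapply (@den_all_iff _ _ _ (fun u => bMem u z)); intro u; [den|].
    eapply den_or; eapply den_upair; den.
  - intro t; cbv beta. apply eq_at_char. intros s u. apply mem_upair.
Qed.

Lemma den_app d r x y z a b c : rep d r x a -> rep d r y b -> rep d r z c ->
  Den d r (t_app x y z) (fun t => pair_name b c \in[t] a).
Proof.
  intros Hx Hy Hz. eapply den_iff.
  - unfold t_app. eapply den_ex; intro u. eapply den_and; [eapply den_pair|]; den.
  - intro t; cbv beta. split.
    + intros (u & E & H). now rewrite <- E.
    + intro H. exists (pair_name b c). split; [reflexivity | exact H].
Qed.

End Arithmetic.

Ltac den_atom ::=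
  lazymatch goal with
  | |- Den _ _ (t_empty _) _ => eapply den_empty
  | |- Den _ _ (t_succ _ _) _ => eapply den_succ
  | |- Den _ _ (Nat _) _ => eapply den_nat
  | |- Den _ _ (PNat _) _ => eapply den_pnat
  | |- Den _ _ (t_pair _ _ _) _ => eapply den_pair
  | |- Den _ _ (t_app _ _ _) _ => eapply den_app
  end.

Section Functions.
Variable T : space.
Implicit Types t s : T.
Implicit Types a b c f p q : name T.
Implicit Types x y z : var.
Implicit Types r : nat -> name T.
Notation num := (num T).

(** P is the meaning of the class A, whatever the environment. *)
Definition class_den (A : class) (P : name T -> T -> Prop) : Prop :=
  forall d r x a, rep d r x a -> Den d r (A x) (P a).

Lemma class_den_eq A P t a b : class_den A P -> a ==[t] b -> P a t -> P b t.
Proof.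
  intros H E K.
  apply (H 1 _ _ _ (rep_bound 0 (fun _ => a) b) t).
  apply (H 1 _ _ _ (rep_bound 0 (fun _ => a) a) t) in K.
  revert K. refine (proj1 (@forces_subst T _ a b _ _ t E _)). intros [|i]; auto.
Qed.

Definition nat_name t a : Prop := exists n, a ==[t] num n.

Definition is_fun t f (P Q : name T -> T -> Prop) : Prop :=
  near t (fun s => forall p, p \in[s] f ->
    exists a, P a s /\ exists b, Q b s /\ p ==[s] pair_name a b) /\
  near t (fun s => forall a, P a s -> exists b, pair_name a b \in[s] f /\
    near s (fun u => forall b', pair_name a b' \in[u] f -> b' ==[u] b)).

Lemma den_maps d r x f A B P Q : class_den A P -> class_den B Q -> rep d r x f ->
  Den d r (maps x A B) (fun t => is_fun t f P Q).
Proof.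
  intros HA HB Hx. unfold maps. eapply den_and.
  - eapply (@den_all_in _ _ _ (fun v : var => bMem v x)); intro p; [den|].
    eapply den_ex; intro. eapply den_and; [eapply HA; den|].
    eapply den_ex; intro. eapply den_and; [eapply HB; den|]. den.
  - eapply (@den_all_in _ _ _ A); intro; [eapply HA; den|].
    unfold ex1. eapply den_ex; intro. eapply den_and; [den|].
    eapply (@den_all_in _ _ _ (fun v : var => t_app x _ v)); den.
Qed.

Lemma is_fun_stable t f P Q : is_fun t f P Q -> near t (fun s => is_fun s f P Q).
Proof. intros [H K]. exact (near_and (near_near H) (near_near K)). Qed.

Definition value t f n b : Prop :=
  pair_name (num n) b \in[t] f /\ (forall b', pair_name (num n) b' \in[t] f -> b' ==[t] b).

Lemma is_fun_value t f B Q n : class_den B Q ->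
  is_fun t f (fun a s => nat_name s a) Q -> exists b, Q b t /\ value t f n b.
Proof.
  intros HB [H K].
  destruct (near_here K (num n)) as (b & Hb & U); [now exists n|].
  destruct (near_here H _ Hb) as (a & _ & b' & Hb' & E). apply pair_eq in E.
  exists b. split; [|split; [exact Hb | exact (near_here U)]].
  destruct E as [_ E]. symmetry in E. exact (class_den_eq HB E Hb').
Qed.

(** The function of the model whose value at n is N (F s n) when seen from the
    point s; F has to be locally constant. *)
Definition graph_name (V : Type) (F : T -> nat -> V) (N : V -> name T) : name T :=
  Name (nat * V) (fun e => pair_name (num (fst e)) (N (snd e)))
    (fun e s => F s (fst e) = snd e).

Section Graph.
Variables (V : Type) (F : T -> nat -> V) (N : V -> name T).
Hypothesis F_loc : forall t n, near t (fun s => F s n = F t n).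

Lemma mem_graph t p :
  p \in[t] graph_name F N <-> exists n, p ==[t] pair_name (num n) (N (F t n)).
Proof.
  split.
  - intros ([n v] & H & E). cbn in *. apply near_here in H. exists n. now rewrite H.
  - intros [n E]. exists (n, F t n). split; [apply F_loc | exact E].
Qed.

Lemma app_graph t n b : pair_name (num n) b \in[t] graph_name F N <-> b ==[t] N (F t n).
Proof.
  rewrite mem_graph. split.
  - intros [m E]. apply pair_eq in E as [En E]. apply num_inj in En. now subst m.
  - intro E. exists n. now rewrite E.
Qed.

Lemma graph_is_fun t (Q : name T -> T -> Prop) :
  (forall s v, Q (N v) s) ->
  is_fun t (graph_name F N) (fun a s => nat_name s a) Q.
Proof.
  intro HQ. split; apply near_all; intro s.
  - intros p Hp. apply mem_graph in Hp as [n E].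
    exists (num n). split; [now exists n|]. eauto.
  - intros a [n E]. exists (N (F s n)). split.
    + rewrite E. now apply app_graph.
    + refine (near_mono _ (near_and (F_loc s n) (eq_at_stable E))). intros u [Fu Eu] b' Hb.
      rewrite Eu in Hb. apply app_graph in Hb. now rewrite <- Fu.
Qed.

End Graph.

(** The terms a and g of an iteration may mention variables of the context;
    this says that d', r' is a deeper context in which they keep their
    meaning. *)
Definition rep_extends d r d' r' : Prop :=
  forall x a, rep d r x a -> rep d' r' x a.

Definition iterates (A : name T -> T -> Prop) (G : name T -> name T -> T -> Prop) a b t : Prop :=
  exists f, is_fun t f (fun a s => nat_name s a) (fun a s => nat_name s a) /\
    (exists c, pair_name (num 0) c \in[t] f /\ A c t) /\
    near t (fun s => forall i, nat_name s i ->
      exists c, pair_name i c \in[s] f /\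
      exists c', pair_name (succ_name i) c' \in[s] f /\ G c c' s) /\
    pair_name a b \in[t] f.

Lemma nat_class : class_den Nat (fun a s => nat_name s a).
Proof. intros d r x a. apply den_nat. Qed.

Lemma den_iter d r (al : term) (g : var -> term) A G x y a b :
  (forall d' r' z c, rep_extends d r d' r' -> rep d' r' z c -> Den d' r' (al z) (A c)) ->
  (forall d' r' z z' c c', rep_extends d r d' r' -> rep d' r' z c -> rep d' r' z' c' ->
    Den d' r' (g z z') (G c c')) ->
  rep d r x a -> rep d r y b ->
  Den d r (t_iter al g x y) (iterates A G a b).
Proof.
  intros HA HG Hx Hy.
  assert (Hl : forall d' r' b, rep_extends d r d' r' -> rep_extends d r (S d') (scons b r')).
  { intros d' r' b' H z c Hz. apply rep_lift. now apply H. }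
  assert (H0 : rep_extends d r d r) by (intros z c; trivial).
  eapply den_iff.
  - unfold t_iter. eapply den_ex; intro f. eapply den_and; [eapply den_maps; [apply nat_class.. | den]|].
    eapply den_and; [|eapply den_and; [|den]].
    + eapply den_ex; intro. eapply den_and; [den|]. eapply den_ex; intro.
      eapply den_and; [den|]. eapply HA; [auto | den].
    + eapply (@den_all_in _ _ _ Nat); intro; [den|].
      eapply den_ex; intro. eapply den_and; [den|]. eapply den_ex; intro.
      eapply den_and; [den|]. eapply den_ex; intro.
      eapply den_and; [den|]. eapply HG; [auto 10 | den..].
  - intro t. cbv beta. split.
    + intros (f & Hf & (z & Ez & c & Hc & HAc) & Hs & Hv). exists f.
      split; [exact Hf|]. split; [exists c; rewrite <- Ez; auto|]. split; [|exact Hv].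
      revert Hs. apply near_mono. intros s Hs i Hi.
      destruct (Hs i Hi) as (j & Ej & c1 & H1 & c2 & H2 & K).
      exists c1. split; [exact H1|]. exists c2. rewrite <- Ej. auto.
    + intros (f & Hf & (c & Hc & HAc) & Hs & Hv). exists f.
      split; [exact Hf|]. split; [exists (num 0); split; [reflexivity | exists c; auto]|].
      split; [|exact Hv].
      revert Hs. apply near_mono. intros s Hs i Hi.
      destruct (Hs i Hi) as (c1 & H1 & c2 & H2 & K).
      exists (succ_name i). split; [reflexivity|]. eauto.
Qed.

(** A step is known only on numerals, and only near t; this is enough, since
    the values of the iteration are numerals.  Uniqueness is by induction
    outside the model, and existence is witnessed by the graph of the
    iteration. *)
Lemma iterates_num t A G a b n k h :
  (forall c, A c t <-> c ==[t] num k) ->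
  near t (fun s => forall l c c', c ==[s] num l -> (G c c' s <-> c' ==[s] num (h l))) ->
  a ==[t] num n ->
  iterates A G a b t <-> b ==[t] num (Nat.iter n h k).
Proof.
  intros HA HG Ea. split.
  - intros (f & Hf & (c & Hc & HAc) & Hs & Hv). apply HA in HAc.
    assert (H : forall m, pair_name (num m) (num (Nat.iter m h k)) \in[t] f).
    { induction m as [|m IH]; [now rewrite <- HAc|].
      destruct (near_here Hs (num m)) as (c1 & H1 & c2 & H2 & K); [now exists m|].
      destruct (is_fun_value m nat_class Hf) as (v & _ & _ & U).
      assert (E : c1 ==[t] num (Nat.iter m h k)) by (rewrite (U _ H1), (U _ IH); reflexivity).
      apply (near_here HG _ _ _ E) in K. cbn. now rewrite <- K. }
    rewrite Ea in Hv. destruct (is_fun_value n nat_class Hf) as (v & _ & _ & U).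
    now rewrite (U _ Hv), (U _ (H n)).
  - intro Eb. set (F := fun (_ : T) m => Nat.iter m h k).
    assert (FL : forall s m, near s (fun u => F u m = F s m)) by (intros; now apply near_all).
    exists (graph_name F num).
    split; [|split; [|split]].
    + apply graph_is_fun; [exact FL|]. intros s v. now exists v.
    + exists (num k). split; [|now apply HA]. now apply (app_graph num FL).
    + revert HG. apply near_mono. intros s HG i [m Ei].
      exists (num (F s m)). rewrite Ei. split; [now apply (app_graph num FL)|].
      exists (num (F s (S m))). split; [rewrite Ei; now apply (app_graph num FL s (S m))|].
      now apply (HG (F s m)).
    + rewrite Ea. now apply (app_graph num FL).
Qed.

Definition nat_add a b : name T -> T -> Prop :=
  iterates (fun c s => c ==[s] a) (fun c c' s => c' ==[s] succ_name c) b.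

Lemma den_add d r x y z a b c : rep d r x a -> rep d r y b -> rep d r z c ->
  Den d r (t_add x y z) (nat_add a b c).
Proof.
  intros Hx Hy Hz. eapply den_iter; trivial.
  - intros d' r' w e H Hw. unfold t_var. pose proof (H _ _ Hx). den.
  - intros d' r' w w' e e' H Hw Hw'. den.
Qed.

Lemma add_num t a b c i j : a ==[t] num i -> b ==[t] num j ->
  nat_add a b c t <-> c ==[t] num (i + j).
Proof.
  intros Ea Eb. unfold nat_add.
  assert (E : forall l, Nat.iter l S i = i + l).
  { intro l. induction l as [|l IH]; [cbn; lia|]. rewrite Nat.iter_succ, IH. lia. }
  rewrite <- (E j). apply iterates_num; trivial.
  - intro e. now rewrite Ea.
  - apply near_all. intros s l e e' El. rewrite El. reflexivity.
Qed.

Definition nat_mul a b : name T -> T -> Prop :=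
  iterates (fun c s => c ==[s] num 0) (fun c => nat_add c a) b.

Lemma den_mul d r x y z a b c : rep d r x a -> rep d r y b -> rep d r z c ->
  Den d r (t_mul x y z) (nat_mul a b c).
Proof.
  intros Hx Hy Hz. eapply den_iter; trivial.
  - intros d' r' w e H Hw. den.
  - intros d' r' w w' e e' H Hw Hw'. pose proof (H _ _ Hx). eapply den_add; den.
Qed.

Lemma mul_num t a b c i j : a ==[t] num i -> b ==[t] num j ->
  nat_mul a b c t <-> c ==[t] num (i * j).
Proof.
  intros Ea Eb. unfold nat_mul.
  assert (E : forall l, Nat.iter l (fun m => m + i) 0 = i * l).
  { intro l. induction l as [|l IH]; [cbn; lia|]. rewrite Nat.iter_succ, IH. lia. }
  rewrite <- (E j). apply iterates_num; trivial.
  - intro e. reflexivity.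
  - refine (near_mono _ (eq_at_stable Ea)). intros s Es l e e' El. now apply add_num.
Qed.

Definition nat_mulmul a b c d e t : Prop :=
  exists u, nat_mul a b u t /\ exists v, nat_mul c d v t /\ nat_add u v e t.

Lemma den_mulmul d r x1 x2 x3 x4 x5 a1 a2 a3 a4 a5 :
  rep d r x1 a1 -> rep d r x2 a2 -> rep d r x3 a3 -> rep d r x4 a4 -> rep d r x5 a5 ->
  Den d r (t_mulmul x1 x2 x3 x4 x5) (nat_mulmul a1 a2 a3 a4 a5).
Proof.
  intros. unfold t_mulmul. eapply den_ex; intro. eapply den_and; [eapply den_mul; den|].
  eapply den_ex; intro. eapply den_and; [eapply den_mul; den | eapply den_add; den].
Qed.

Lemma mulmul_num t a b c d e i j k l :
  a ==[t] num i -> b ==[t] num j -> c ==[t] num k -> d ==[t] num l ->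
  nat_mulmul a b c d e t <-> e ==[t] num (i * j + k * l).
Proof.
  intros Ea Eb Ec Ed. split.
  - intros (u & Hu & v & Hv & H). apply (mul_num _ Ea Eb) in Hu.
    apply (mul_num _ Ec Ed) in Hv. now apply (add_num _ Hu Hv) in H.
  - intro E. exists (num (i * j)). split; [now apply (mul_num _ Ea Eb)|].
    exists (num (k * l)). split; [now apply (mul_num _ Ec Ed)|].
    now apply (@add_num t (num (i * j)) (num (k * l)) e (i * j) (k * l)).
Qed.

End Functions.

(** * Rational numbers in the model *)

Local Open Scope R_scope.

(** (i, j, k) stands for (i - j) / (k + 1): a shift of the denominator spares
    the condition that it is not zero. *)
Definition triple : Set := nat * nat * nat.

Definition val (v : triple) : R :=
  let '(i, j, k) := v in (INR i - INR j) / INR (S k).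

Lemma INR_S_pos k : 0 < INR (S k).
Proof. apply lt_0_INR. lia. Qed.

Lemma frac_cross (i j k i' j' k' : nat) :
  (val (i, j, k) - val (i', j', k')) * (INR (S k) * INR (S k')) =
  INR (i * S k' + j' * S k) - INR (i' * S k + j * S k').
Proof.
  rewrite !plus_INR, !mult_INR. unfold val.
  pose proof (INR_S_pos k). pose proof (INR_S_pos k'). field. lra.
Qed.

Lemma val_eq i j k i' j' k' : val (i, j, k) = val (i', j', k') <->
  (i * S k' + j' * S k = i' * S k + j * S k')%nat.
Proof.
  pose proof (frac_cross i j k i' j' k') as E.
  pose proof (Rmult_lt_0_compat _ _ (INR_S_pos k) (INR_S_pos k')) as P. split.
  - intro H. rewrite H, Rminus_diag, Rmult_0_l in E. apply INR_eq. lra.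
  - intro H. rewrite H, Rminus_diag in E. apply Rmult_integral in E. lra.
Qed.

Lemma val_lt i j k i' j' k' : val (i, j, k) < val (i', j', k') <->
  (i * S k' + j' * S k < i' * S k + j * S k')%nat.
Proof.
  pose proof (frac_cross i j k i' j' k') as E.
  pose proof (Rmult_lt_0_compat _ _ (INR_S_pos k) (INR_S_pos k')) as P. split.
  - intro H. apply INR_lt. nra.
  - intro H. apply lt_INR in H. nra.
Qed.

Definition vadd (v w : triple) : triple :=
  let '(i, j, k) := v in let '(i', j', k') := w in
  (i * S k' + i' * S k, j * S k' + j' * S k, S k * S k' - 1)%nat.

Lemma S_den k k' : S (S k * S k' - 1) = (S k * S k')%nat.
Proof. lia. Qed.

Lemma val_add v w : val (vadd v w) = val v + val w.
Proof.
  destruct v as [[i j] k], w as [[i' j'] k']. unfold vadd, val. rewrite S_den.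
  rewrite !plus_INR, !mult_INR.
  pose proof (INR_S_pos k). pose proof (INR_S_pos k'). field. lra.
Qed.

Definition vopp (v : triple) : triple := let '(i, j, k) := v in (j, i, k).

Lemma val_opp v : val (vopp v) = - val v.
Proof.
  destruct v as [[i j] k]. unfold vopp, val. pose proof (INR_S_pos k). field. lra.
Qed.

Definition vabs (v : triple) : triple := let '(i, j, k) := v in
  if i <? j then (j, i, k) else v.

Lemma val_abs v : val (vabs v) = Rabs (val v).
Proof.
  destruct v as [[i j] k]. pose proof (Rinv_0_lt_compat _ (INR_S_pos k)). unfold vabs.
  destruct (Nat.ltb_spec i j) as [L | L].
  - apply lt_INR in L. rewrite Rabs_left; [apply (val_opp (i, j, k))|]. unfold val, Rdiv. nra.
  - apply le_INR in L. rewrite Rabs_right; [reflexivity|]. unfold val, Rdiv. nra.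
Qed.

Definition vdist (v w : triple) : triple := vabs (vadd v (vopp w)).

Lemma val_dist v w : val (vdist v w) = Rabs (val v - val w).
Proof. unfold vdist. now rewrite val_abs, val_add, val_opp. Qed.

Definition rational (q : R) : Prop := exists v, val v = q.

Section Rationals.
Variable T : space.
Implicit Types t s : T.
Implicit Types a b c f p q : name T.
Implicit Types x y z : var.
Implicit Types r : nat -> name T.
Notation num := (num T).

Definition triple_name (v : triple) : name T :=
  let '(i, j, k) := v in pair_name (pair_name (num i) (num j)) (num (S k)).

(** The set of all the triples that represent rho, so that equal fractions have
    equal names. *)
Definition rat_name (rho : R) : name T := Name triple triple_name (fun v _ => val v = rho).

Lemma triple_eq t v w : triple_name v ==[t] triple_name w <-> v = w.
Proof.
  destruct v as [[i j] k], w as [[i' j'] k']. unfold triple_name.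
  rewrite !pair_eq, !num_inj. split; [intros [[-> ->] [= ->]] | intros [= -> -> ->]]; auto.
Qed.

Lemma mem_rat t c rho : c \in[t] rat_name rho <-> exists v, val v = rho /\ c ==[t] triple_name v.
Proof.
  split.
  - intros (v & H & E). apply near_here in H. now exists v.
  - intros (v & H & E). exists v. split; [now apply near_all | exact E].
Qed.

(** At the point t, the name a is the rational number rho.  Rationality is
    required because the names of irrational reals are all empty. *)
Definition is_rat t a (rho : R) : Prop := rational rho /\ a ==[t] rat_name rho.

Lemma is_rat_fun t a rho sigma : is_rat t a rho -> is_rat t a sigma -> rho = sigma.
Proof.
  intros [[v Hv] E] [_ E']. rewrite E in E'.
  assert (H : triple_name v \in[t] rat_name rho) by (apply mem_rat; exists v; split; [exact Hv | reflexivity]).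
  rewrite E' in H. apply mem_rat in H as (w & <- & Ew). apply triple_eq in Ew. now rewrite <- Ew.
Qed.

Lemma is_rat_stable t a rho : is_rat t a rho -> near t (fun s => is_rat s a rho).
Proof.
  intros [H E]. refine (near_mono _ (eq_at_stable E)). intros s Es. now split.
Qed.

Lemma is_rat_name t rho : rational rho -> is_rat t (rat_name rho) rho.
Proof. intro H. split; [exact H | reflexivity]. Qed.

Lemma is_rat_eq t a b rho : is_rat t a rho -> is_rat t b rho -> a ==[t] b.
Proof. intros [_ E] [_ E']. now rewrite E, E'. Qed.

Lemma rational_val v : rational (val v).
Proof. now exists v. Qed.

Lemma rational_add (x y : R) : rational x -> rational y -> rational (x + y).
Proof. intros [v <-] [w <-]. exists (vadd v w). apply val_add. Qed.

Lemma rational_opp (x : R) : rational x -> rational (- x).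
Proof. intros [v <-]. exists (vopp v). apply val_opp. Qed.

Lemma rational_0 : rational 0.
Proof. exists (0, 0, 0)%nat. unfold val. cbn. lra. Qed.

Lemma rational_inv k : rational (/ INR (S k)).
Proof.
  exists (1, 0, k)%nat. unfold val. pose proof (INR_S_pos k).
  replace (INR 1 - INR 0) with 1 by (cbn; lra). lra.
Qed.

Definition frac_of a b c a' b' c' t : Prop :=
  exists e, nat_mulmul a c' b' c e t /\ nat_mulmul a' c b c' e t.

Lemma den_frac_eq d r x1 x2 x3 x4 x5 x6 a1 a2 a3 a4 a5 a6 :
  rep d r x1 a1 -> rep d r x2 a2 -> rep d r x3 a3 -> rep d r x4 a4 -> rep d r x5 a5 ->
  rep d r x6 a6 -> Den d r (frac_eq x1 x2 x3 x4 x5 x6) (frac_of a1 a2 a3 a4 a5 a6).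
Proof.
  intros. unfold frac_eq. eapply den_ex; intro. eapply den_and; eapply den_mulmul; den.
Qed.

Lemma frac_of_num t a b c a' b' c' i j k i' j' k' :
  a ==[t] num i -> b ==[t] num j -> c ==[t] num (S k) ->
  a' ==[t] num i' -> b' ==[t] num j' -> c' ==[t] num (S k') ->
  frac_of a b c a' b' c' t <-> val (i, j, k) = val (i', j', k').
Proof.
  intros Ea Eb Ec Ea' Eb' Ec'. rewrite val_eq. split.
  - intros (e & H & K). apply (mulmul_num _ Ea Ec' Eb' Ec) in H.
    apply (mulmul_num _ Ea' Ec Eb Ec') in K. rewrite H in K. now apply num_inj in K.
  - intro E. exists (num (i * S k' + j' * S k)).
    split; [now apply (mulmul_num _ Ea Ec' Eb' Ec)|].
    apply (mulmul_num _ Ea' Ec Eb Ec'). now rewrite E.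
Qed.

Definition is_frac a b c q t : Prop := exists i j k,
  a ==[t] num i /\ b ==[t] num j /\ c ==[t] num (S k) /\ is_rat t q (val (i, j, k)).

(** Once a, b and c are numerals, which is a condition on a neighbourhood, the
    equation that defines the class of (a - b) / c is an equation between
    reals. *)
Lemma den_frac d r x y z w a b c q :
  rep d r x a -> rep d r y b -> rep d r z c -> rep d r w q ->
  Den d r (t_frac x y z w) (is_frac a b c q).
Proof.
  intros Hx Hy Hz Hw. eapply den_iff.
  - unfold t_frac. eapply den_and; [eapply den_nat; den|].
    eapply den_and; [eapply den_nat; den|]. eapply den_and; [eapply den_pnat; den|].
    eapply (@den_all_iff _ _ _ (fun v : var => bMem v w)); intro; [den|].
    eapply den_ex; intro. eapply den_and; [eapply den_nat; den|].
    eapply den_ex; intro. eapply den_and; [eapply den_nat; den|].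
    eapply den_ex; intro. eapply den_and; [eapply den_pnat; den|].
    eapply den_and; [unfold t_triple; den | eapply den_frac_eq; den].
  - intro t; cbv beta.
    enough (L : forall i j k, a ==[t] num i -> b ==[t] num j -> c ==[t] num (S k) ->
      near t (fun s => forall p, p \in[s] q <->
        (exists a', (exists n, a' ==[s] num n) /\ exists b', (exists n, b' ==[s] num n) /\
         exists c', (exists n, c' ==[s] num (S n)) /\
         (exists p', p' ==[s] pair_name a' b' /\ p ==[s] pair_name p' c') /\
         frac_of a b c a' b' c' s)) <-> is_rat t q (val (i, j, k))).
    { split.
      - intros ([i Ei] & [j Ej] & [k Ek] & H). exists i, j, k. repeat (split; [assumption|]).
        now apply L.
      - intros (i & j & k & Ei & Ej & Ek & H). split; [eauto|]. split; [eauto|].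
        split; [eauto|]. now apply (L i j k). }
    intros i j k Ea Eb Ec.
    assert (near t (fun s => a ==[s] num i /\ b ==[s] num j /\ c ==[s] num (S k))) as N
      by (repeat apply near_and; now apply eq_at_stable).
    transitivity (q ==[t] rat_name (val (i, j, k))); [|unfold is_rat; split; [split; [apply rational_val|]; assumption | tauto]].
    rewrite eq_at_ext. 
    assert (K : near t (fun s => forall p, p \in[s] rat_name (val (i, j, k)) <->
       (exists a', (exists n, a' ==[s] num n) /\ exists b', (exists n, b' ==[s] num n) /\
         exists c', (exists n, c' ==[s] num (S n)) /\
         (exists p', p' ==[s] pair_name a' b' /\ p ==[s] pair_name p' c') /\
         frac_of a b c a' b' c' s))).
    { revert N. apply near_mono. intros s (Ea' & Eb' & Ec') p. rewrite mem_rat. split.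
      - intros ([[i' j'] k'] & Hv & E). exists (num i'). split; [exists i'; reflexivity|].
        exists (num j'). split; [exists j'; reflexivity|].
        exists (num (S k')). split; [exists k'; reflexivity|].
        split; [now exists (pair_name (num i') (num j'))|].
        apply (@frac_of_num s _ _ _ _ _ _ i j k i' j' k'); auto; reflexivity.
      - intros (a' & [i' Ei] & b' & [j' Ej] & c' & [k' Ek] & (p' & Ep' & Ep) & H).
        exists (i', j', k'). split.
        + symmetry. now apply (frac_of_num Ea' Eb' Ec' Ei Ej Ek).
        + rewrite Ep, Ep', Ei, Ej, Ek. reflexivity. }
    split; intro H; refine (near_mono _ (near_and H K)); intros s [Hs Ks] p;
      [rewrite Hs, Ks | rewrite Hs, <- Ks]; reflexivity.
Qed.

Lemma frac_exists t q rho : is_rat t q rho -> exists a b c, is_frac a b c q t.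
Proof.
  intros [[[[i j] k] <-] E]. exists (num i), (num j), (num (S k)), i, j, k.
  repeat (split; [reflexivity|]). split; [apply rational_val | exact E].
Qed.

Lemma frac_rat t a b c q : is_frac a b c q t -> exists rho, is_rat t q rho.
Proof. intros (i & j & k & _ & _ & _ & H). eauto. Qed.

Lemma den_rat : class_den Rat (fun q t => exists rho, is_rat t q rho).
Proof.
  intros d r x q Hx. eapply den_iff.
  - unfold Rat. eapply den_ex; intro. eapply den_ex; intro. eapply den_ex; intro.
    eapply den_frac; den.
  - intro t; cbv beta. split.
    + intros (a & b & c & H). exact (frac_rat H).
    + intros [rho H]. exact (frac_exists H).
Qed.

Lemma den_rat_lt d r x y p q : rep d r x p -> rep d r y q ->
  Den d r (rat_lt x y)
    (fun t => exists rho sigma, is_rat t p rho /\ is_rat t q sigma /\ rho < sigma).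
Proof.
  intros Hx Hy. eapply den_iff.
  - unfold rat_lt. do 6 (eapply den_ex; intro).
    eapply den_and; [eapply den_frac; den|]. eapply den_and; [eapply den_frac; den|].
    eapply den_ex; intro. eapply den_and; [eapply den_mulmul; den|].
    eapply den_ex; intro. eapply den_and; [eapply den_mulmul; den|]. den.
  - intro t; cbv beta. split.
    + intros (a & b & c & a' & b' & c' & (i & j & k & Ea & Eb & Ec & H) &
              (i' & j' & k' & Ea' & Eb' & Ec' & H') & e & He & e' & He' & L).
      exists (val (i, j, k)), (val (i', j', k')). split; [exact H|]. split; [exact H'|].
      apply val_lt. apply (mulmul_num _ Ea Ec' Eb' Ec) in He.
      apply (mulmul_num _ Ea' Ec Eb Ec') in He'. rewrite He, He' in L. now apply num_mem in L.
    + intros (rho & sigma & [[[[i j] k] <-] E] & [[[[i' j'] k'] <-] E'] & L).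
      exists (num i), (num j), (num (S k)), (num i'), (num j'), (num (S k')).
      split; [exists i, j, k; repeat (split; [reflexivity|]); split; [apply rational_val | exact E]|].
      split; [exists i', j', k'; repeat (split; [reflexivity|]); split; [apply rational_val | exact E']|].
      apply val_lt in L.
      exists (num (i * S k' + j' * S k)). split; [now apply (@mulmul_num T t _ _ _ _ _ i (S k') j' (S k))|].
      exists (num (i' * S k + j * S k')). split; [now apply (@mulmul_num T t _ _ _ _ _ i' (S k) j (S k'))|].
      now apply num_mem.
Qed.

Lemma den_rat_add d r x y z p q c : rep d r x p -> rep d r y q -> rep d r z c ->
  Den d r (t_rat_add x y z)
    (fun t => exists rho sigma, is_rat t p rho /\ is_rat t q sigma /\ is_rat t c (rho + sigma)).
Proof.
  intros Hx Hy Hz. eapply den_iff.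
  - unfold t_rat_add. do 6 (eapply den_ex; intro).
    eapply den_and; [eapply den_frac; den|]. eapply den_and; [eapply den_frac; den|].
    eapply den_ex; intro. eapply den_and; [eapply den_mulmul; den|].
    eapply den_ex; intro. eapply den_and; [eapply den_mulmul; den|].
    eapply den_ex; intro. eapply den_and; [eapply den_mul; den|]. eapply den_frac; den.
  - intro t; cbv beta. split.
    + intros (a1 & b1 & c1 & a2 & b2 & c2 & (i & j & k & Ea & Eb & Ec & H) &
              (i' & j' & k' & Ea' & Eb' & Ec' & H') & u & Hu & v & Hv & w & Hw & K).
      exists (val (i, j, k)), (val (i', j', k')). split; [exact H|]. split; [exact H'|].
      apply (mulmul_num _ Ea Ec' Ea' Ec) in Hu. apply (mulmul_num _ Eb Ec' Eb' Ec) in Hv.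
      apply (mul_num _ Ec Ec') in Hw.
      destruct K as (i2 & j2 & k2 & E1 & E2 & E3 & K).
      rewrite Hu in E1. rewrite Hv in E2. rewrite Hw in E3.
      apply num_inj in E1, E2, E3. rewrite <- val_add. unfold vadd.
      replace (S k * S k' - 1)%nat with k2 by lia. now rewrite E1, E2.
    + intros (rho & sigma & [[[[i j] k] <-] E] & [[[[i' j'] k'] <-] E'] & K).
      exists (num i), (num j), (num (S k)), (num i'), (num j'), (num (S k')).
      split; [exists i, j, k; repeat (split; [reflexivity|]); split; [apply rational_val | exact E]|].
      split; [exists i', j', k'; repeat (split; [reflexivity|]); split; [apply rational_val | exact E']|].
      exists (num (i * S k' + i' * S k)). split; [now apply (@mulmul_num T t _ _ _ _ _ i (S k') i' (S k))|].
      exists (num (j * S k' + j' * S k)). split; [now apply (@mulmul_num T t _ _ _ _ _ j (S k') j' (S k))|].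
      exists (num (S k * S k')). split; [now apply (@mul_num T t _ _ _ (S k) (S k'))|].
      exists (i * S k' + i' * S k)%nat, (j * S k' + j' * S k)%nat, (S k * S k' - 1)%nat.
      rewrite S_den. repeat (split; [reflexivity|]).
      rewrite <- val_add in K. exact K.
Qed.

Lemma den_rat_opp d r x y p q : rep d r x p -> rep d r y q ->
  Den d r (t_rat_opp x y) (fun t => exists rho, is_rat t p rho /\ is_rat t q (- rho)).
Proof.
  intros Hx Hy. eapply den_iff.
  - unfold t_rat_opp. do 3 (eapply den_ex; intro).
    eapply den_and; [eapply den_frac; den|]. eapply den_frac; den.
  - intro t; cbv beta. split.
    + intros (a & b & c & (i & j & k & Ea & Eb & Ec & H) & (j' & i' & k' & Eb' & Ea' & Ec' & H')).
      exists (val (i, j, k)). split; [exact H|]. rewrite <- val_opp. unfold vopp.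
      rewrite Ea in Ea'. rewrite Eb in Eb'. rewrite Ec in Ec'.
      apply num_inj in Ea', Eb', Ec'. injection Ec' as ->. now subst.
    + intros (rho & [[[[i j] k] <-] E] & H).
      exists (num i), (num j), (num (S k)).
      split; [exists i, j, k | exists j, i, k]; repeat (split; [reflexivity|]).
      * split; [apply rational_val | exact E].
      * rewrite <- val_opp in H. exact H.
Qed.

Lemma den_rat_inv d r x y a q : rep d r x a -> rep d r y q ->
  Den d r (t_rat_inv x y) (fun t => exists k, a ==[t] num (S k) /\ is_rat t q (/ INR (S k))).
Proof.
  intros Hx Hy. eapply den_iff.
  - unfold t_rat_inv. eapply den_ex; intro. eapply den_and; [den|].
    eapply den_ex; intro. eapply den_and; [den | eapply den_frac; den].
  - intro t; cbv beta.
    assert (V : forall k, val (1, 0, k)%nat = / INR (S k)).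
    { intro k. unfold val. pose proof (INR_S_pos k).
      replace (INR 1 - INR 0) with 1 by (cbn; lra). lra. }
    split.
    + intros (z & Ez & o & Eo & (i & j & k & Ei & Ej & Ek & H)). exists k. split; [exact Ek|].
      rewrite Ez in Ej. rewrite Eo, Ez in Ei.
      change (num 1 ==[t] num i) in Ei. apply num_inj in Ei, Ej. subst i j. now rewrite <- V.
    + intros (k & Ek & H). exists (num 0). split; [reflexivity|]. exists (num 1).
      split; [reflexivity|]. exists 1%nat, 0%nat, k. repeat (split; [reflexivity|]).
      split; [exact Ek|]. now rewrite V.
Qed.

Lemma den_rat_zero d r y q : rep d r y q ->
  Den d r (t_rat_zero y) (fun t => is_rat t q 0).
Proof.
  intros Hy. eapply den_iff.
  - unfold t_rat_zero. eapply den_ex; intro. eapply den_and; [den|].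
    eapply den_ex; intro. eapply den_and; [den | eapply den_frac; den].
  - intro t; cbv beta.
    assert (V : forall k, val (0, 0, k)%nat = 0).
    { intro k. unfold val. rewrite Rminus_diag. apply Rmult_0_l. }
    split.
    + intros (z & Ez & o & Eo & (i & j & k & Ei & Ej & Ek & H)).
      rewrite Ez in Ei, Ej. apply num_inj in Ei, Ej. subst i j. now rewrite <- (V k).
    + intro H. exists (num 0). split; [reflexivity|]. exists (num 1).
      split; [reflexivity|]. exists 0%nat, 0%nat, 0%nat. repeat (split; [reflexivity|]).
      now rewrite V.
Qed.

Lemma den_prat : class_den PRat (fun q t => exists rho, is_rat t q rho /\ 0 < rho).
Proof.
  intros d r x q Hx. eapply den_iff.
  - unfold PRat. eapply den_and; [eapply den_rat; den|]. eapply den_ex; intro.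
    eapply den_and; [eapply den_rat_zero; den | eapply den_rat_lt; den].
  - intro t; cbv beta. split.
    + intros (_ & z & Hz & rho & sigma & Hr & Hs & L). exists sigma.
      now rewrite (is_rat_fun Hz Hr).
    + intros (rho & H & L). split; [eauto|]. exists (rat_name 0).
      pose proof (is_rat_name t rational_0). split; [assumption|]. exists 0, rho. auto.
Qed.

Lemma den_rat_abs d r x y p q : rep d r x p -> rep d r y q ->
  Den d r (t_rat_abs x y) (fun t => exists rho, is_rat t p rho /\ is_rat t q (Rabs rho)).
Proof.
  intros Hx Hy. eapply den_iff.
  - unfold t_rat_abs. eapply den_ex; intro. eapply den_and; [eapply den_rat_zero; den|].
    eapply den_or.
    + eapply den_and; [eapply den_rat_lt; den | eapply den_rat_opp; den].
    + eapply den_and; [eapply den_rat; den|]. eapply den_and; [|den].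
      eapply den_imp; [eapply den_rat_lt; den | den].
  - intro t; cbv beta. split.
    + intros (z & Hz & [[(rho & sigma & Hr & Hs & L) (rho' & Hr' & Hq)] | [[rho Hr] [N E]]]).
      * exists rho. split; [exact Hr|]. rewrite (is_rat_fun Hs Hz) in L.
        rewrite Rabs_left by exact L. now rewrite (is_rat_fun Hr Hr').
      * exists rho. split; [exact Hr|]. rewrite Rabs_right.
        -- destruct Hr as [H1 H2]. split; [exact H1 | now rewrite E].
        -- apply Rnot_lt_ge. intro L. apply (near_here N). exists rho, 0. auto.
    + intros (rho & Hr & Hq). exists (rat_name 0).
      pose proof (is_rat_name t rational_0) as Hz. split; [exact Hz|].
      destruct (Rlt_dec rho 0) as [L | L].
      * left. split; [exists rho, 0; auto|]. rewrite Rabs_left in Hq by exact L. eauto.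
      * right. rewrite Rabs_right in Hq by lra. split; [eauto|].
        split; [|exact (is_rat_eq Hq Hr)].
        refine (near_mono _ (is_rat_stable Hr)).
        intros s Hs (rho' & sigma & H1 & H2 & L').
        rewrite (is_rat_fun H1 Hs), (is_rat_fun H2 (is_rat_name s rational_0)) in L'. lra.
Qed.

Lemma den_rat_dist d r x y z p q c : rep d r x p -> rep d r y q -> rep d r z c ->
  Den d r (t_rat_dist x y z)
    (fun t => exists rho sigma, is_rat t p rho /\ is_rat t q sigma /\
                is_rat t c (Rabs (rho - sigma))).
Proof.
  intros Hx Hy Hz. eapply den_iff.
  - unfold t_rat_dist. eapply den_ex; intro. eapply den_and; [eapply den_rat_opp; den|].
    eapply den_ex; intro. eapply den_and; [eapply den_rat_add; den | eapply den_rat_abs; den].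
  - intro t; cbv beta. split.
    + intros (q' & (sigma & Hs & Hs') & u & (rho & tau & Hr & Ht & Hu) & (w & Hw & Hc)).
      exists rho, sigma. split; [exact Hr|]. split; [exact Hs|].
      rewrite <- (is_rat_fun Hu Hw), (is_rat_fun Ht Hs') in Hc. exact Hc.
    + intros (rho & sigma & Hr & Hs & Hc).
      pose proof (rational_opp (proj1 Hs)) as Ro.
      pose proof (rational_add (proj1 Hr) Ro) as Ra.
      exists (rat_name (- sigma)). split; [exists sigma; split; [exact Hs | now apply is_rat_name]|].
      exists (rat_name (rho + - sigma)). split.
      * exists rho, (- sigma). split; [exact Hr|]. split; now apply is_rat_name.
      * exists (rho + - sigma). split; [now apply is_rat_name | exact Hc].
Qed.

End Rationals.

(** * Cauchy sequences in the model *)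

Ltac den_atom ::=
  lazymatch goal with
  | |- Den _ _ (t_empty _) _ => eapply den_empty
  | |- Den _ _ (t_succ _ _) _ => eapply den_succ
  | |- Den _ _ (Nat _) _ => eapply den_nat
  | |- Den _ _ (PNat _) _ => eapply den_pnat
  | |- Den _ _ (t_pair _ _ _) _ => eapply den_pair
  | |- Den _ _ (t_app _ _ _) _ => eapply den_app
  | |- Den _ _ (Rat _) _ => eapply den_rat
  | |- Den _ _ (PRat _) _ => eapply den_prat
  | |- Den _ _ (rat_lt _ _) _ => eapply den_rat_lt
  | |- Den _ _ (t_rat_add _ _ _) _ => eapply den_rat_add
  | |- Den _ _ (t_rat_inv _ _) _ => eapply den_rat_inv
  | |- Den _ _ (t_rat_dist _ _ _) _ => eapply den_rat_dist
  end.

Section Sequences.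
Variable T : space.
Implicit Types t s u : T.
Implicit Types a b c e f p q : name T.
Implicit Types x y z : var.
Implicit Types r : nat -> name T.
Notation num := (num T).

Definition sequence t a : Prop :=
  is_fun t a (fun i s => nat_name s i) (fun q s => exists rho, is_rat s q rho).

Definition entry t a n (rho : R) : Prop :=
  exists q, pair_name (num n) q \in[t] a /\ is_rat t q rho.

Lemma entry_exists t a n : sequence t a -> exists rho, entry t a n rho.
Proof.
  intro H. destruct (is_fun_value n (@den_rat T) H) as (q & [rho Hq] & [Hv _]).
  exists rho, q. auto.
Qed.

Lemma entry_fun t a n rho sigma :
  sequence t a -> entry t a n rho -> entry t a n sigma -> rho = sigma.
Proof.
  intros H (q & Hq & Rq) (p & Hp & Rp).
  destruct (is_fun_value n (@den_rat T) H) as (v & _ & _ & U).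
  apply (@is_rat_fun T t q); [exact Rq|]. destruct Rp as [R1 R2]. split; [exact R1|].
  now rewrite (U _ Hq), <- (U _ Hp).
Qed.

Lemma entry_stable t a n rho : entry t a n rho -> near t (fun s => entry s a n rho).
Proof.
  intros (q & Hq & Rq). refine (near_mono _ (near_and (mem_at_stable Hq) (is_rat_stable Rq))).
  intros s [H K]. now exists q.
Qed.

Lemma den_sequence d r x a : rep d r x a -> Den d r (maps x Nat Rat) (fun t => sequence t a).
Proof. intro Hx. eapply den_maps; [apply nat_class | apply den_rat | exact Hx]. Qed.

Definition is_dist (D a b : name T) t : Prop := sequence t D /\
  near t (fun s => forall i, nat_name s i ->
    exists q, pair_name i q \in[s] a /\ exists p, pair_name i p \in[s] b /\
    exists e, (exists rho sigma, is_rat s q rho /\ is_rat s p sigma /\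
                is_rat s e (Rabs (rho - sigma))) /\ pair_name i e \in[s] D).

Definition is_const (E q : name T) t : Prop := sequence t E /\
  near t (fun s => forall i, nat_name s i -> pair_name i q \in[s] E).

(** The meaning of [seq_lt], as [is_dist], [is_const] and [closer] are those of
    [t_seq_dist], [t_seq_const] and [dist_lt]. *)
Definition below a b t : Prop :=
  exists m, (exists k, m ==[t] num (S k)) /\ exists N, nat_name t N /\
  near t (fun s => forall i, nat_name s i -> near s (fun u => N \in[u] i ->
    exists q, pair_name i q \in[u] a /\ exists p, pair_name i p \in[u] b /\
    exists e, (exists k, m ==[u] num (S k) /\ is_rat u e (/ INR (S k))) /\
    exists c, (exists rho sigma, is_rat u q rho /\ is_rat u e sigma /\
                 is_rat u c (rho + sigma)) /\
    exists rho sigma, is_rat u c rho /\ is_rat u p sigma /\ rho < sigma)).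

Definition closer a b e t : Prop :=
  exists D, is_dist D a b t /\ exists E, is_const E e t /\ below D E t.

Lemma den_closer d r x y z a b e : rep d r x a -> rep d r y b -> rep d r z e ->
  Den d r (dist_lt x y z) (closer a b e).
Proof.
  intros Hx Hy Hz. unfold dist_lt, t_seq_dist, t_seq_const, seq_lt.
  eapply den_ex; intro D. eapply den_and.
  { eapply den_and; [eapply den_sequence; den|].
    eapply (@den_all_in _ _ _ Nat); den. }
  eapply den_ex; intro E. eapply den_and.
  { eapply den_and; [eapply den_sequence; den|].
    eapply (@den_all_in _ _ _ Nat); den. }
  eapply den_ex; intro m. eapply den_and; [den|].
  eapply den_ex; intro N. eapply den_and; [den|].
  eapply (@den_all_in _ _ _ Nat); den.
Qed.

Definition pos_rat t e : Prop := exists rho, is_rat t e rho /\ 0 < rho.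

Definition cauchy a t : Prop := sequence t a /\
  near t (fun s => forall e, pos_rat s e -> exists N, nat_name s N /\
    near s (fun s1 => forall i, nat_name s1 i ->
    near s1 (fun s2 => forall j, nat_name s2 j ->
    near s2 (fun u => N \in[u] i /\ N \in[u] j ->
      exists q, pair_name i q \in[u] a /\ exists p, pair_name j p \in[u] a /\
      exists c, (exists rho sigma, is_rat u q rho /\ is_rat u p sigma /\
                  is_rat u c (Rabs (rho - sigma))) /\
      exists rho sigma, is_rat u c rho /\ is_rat u e sigma /\ rho < sigma)))).

Lemma den_cauchy : class_den CauchySeq cauchy.
Proof.
  intros d r x a Hx. unfold CauchySeq. eapply den_and; [eapply den_sequence; den|].
  eapply (@den_all_in _ _ _ PRat); intro e; [den|].
  eapply den_ex; intro N. eapply den_and; [den|].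
  eapply (@den_all_in _ _ _ Nat); intro; [den|].
  eapply (@den_all_in _ _ _ Nat); den.
Qed.

Definition cauchy_cauchy a t : Prop :=
  is_fun t a (fun i s => nat_name s i) cauchy /\
  near t (fun s => forall e, pos_rat s e -> exists N, nat_name s N /\
    near s (fun s1 => forall i, nat_name s1 i ->
    near s1 (fun s2 => forall j, nat_name s2 j ->
    near s2 (fun u => N \in[u] i /\ N \in[u] j ->
      exists b, pair_name i b \in[u] a /\ exists c, pair_name j c \in[u] a /\
      closer b c e u)))).

Lemma den_cauchy_cauchy : class_den CauchySeqSeq cauchy_cauchy.
Proof.
  intros d r x a Hx. unfold CauchySeqSeq.
  eapply den_and; [eapply den_maps; [apply nat_class | apply den_cauchy | exact Hx]|].
  eapply (@den_all_in _ _ _ PRat); intro e; [den|].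
  eapply den_ex; intro N. eapply den_and; [den|].
  eapply (@den_all_in _ _ _ Nat); intro; [den|].
  eapply (@den_all_in _ _ _ Nat); intro; [den|].
  eapply den_imp; [den|]. eapply den_ex; intro. eapply den_and; [den|].
  eapply den_ex; intro. eapply den_and; [den | eapply den_closer; den].
Qed.

Definition converges a b t : Prop :=
  near t (fun s => forall e, pos_rat s e -> exists N, nat_name s N /\
    near s (fun s1 => forall i, nat_name s1 i ->
    near s1 (fun u => N \in[u] i -> exists c, pair_name i c \in[u] a /\ closer c b e u))).

Lemma den_converges d r x y a b : rep d r x a -> rep d r y b ->
  Den d r (converges_to x y) (converges a b).
Proof.
  intros Hx Hy. unfold converges_to.
  eapply (@den_all_in _ _ _ PRat); intro e; [den|].
  eapply den_ex; intro N. eapply den_and; [den|].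
  eapply (@den_all_in _ _ _ Nat); intro; [den|].
  eapply den_imp; [den|]. eapply den_ex; intro. eapply den_and; [den | eapply den_closer; den].
Qed.

Lemma forces_completeness r t : forces r cauchy_completeness t <->
  near t (fun s => forall a, cauchy_cauchy a s -> exists b, cauchy b s /\ converges a b s).
Proof.
  revert t. change (Den 0 r (bAll (fun X => bImp (CauchySeqSeq X)
    (bEx (fun Y => bAnd (CauchySeq Y) (converges_to X Y)))))
    (fun t => near t (fun s => forall a, cauchy_cauchy a s -> exists b, cauchy b s /\ converges a b s))).
  eapply (@den_all_in _ _ _ CauchySeqSeq); intro a; [eapply den_cauchy_cauchy; den|].
  eapply den_ex; intro b. eapply den_and; [eapply den_cauchy; den | eapply den_converges; den].
Qed.

Lemma nat_mem t (N i : name T) k l : N ==[t] num k -> i ==[t] num l -> N \in[t] i <-> (k < l)%nat.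
Proof. intros -> ->. apply num_mem. Qed.

(** The distance sequence and the constant sequence of the definition are
    functions of the model, so their values can be compared with the ones that
    are computed from the entries. *)
Lemma closer_entry t a b e eps : closer a b e t -> is_rat t e eps ->
  exists N, forall n, (N < n)%nat ->
    exists rho sigma, entry t a n rho /\ entry t b n sigma /\ Rabs (rho - sigma) < eps.
Proof.
  intros (D & [HD HD'] & E & [HE HE'] & m & [k Ek] & M & [N EN] & L) He.
  exists N. intros n Hn.
  assert (Hnn : nat_name t (num n)) by (now exists n).
  destruct (near_here HD' _ Hnn) as (q & Hq & p & Hp & w & (rho & sigma & Rq & Rp & Rw) & Hw).
  pose proof (near_here HE' _ Hnn) as Hc.
  destruct (near_here (near_here L _ Hnn)) as
    (d & Hd & d' & Hd' & i & (l & _ & Ri) & c & (x1 & x2 & R1 & R2 & R3) & y1 & y2 & S1 & S2 & Lt).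
  { apply (nat_mem EN (reflexivity _)). exact Hn. }
  exists rho, sigma. split; [now exists q|]. split; [now exists p|].
  assert (E1 : x1 = Rabs (rho - sigma)).
  { apply (@entry_fun t D n); [exact HD | now exists d | now exists w]. }
  assert (E2 : y2 = eps).
  { apply (@entry_fun t E n); [exact HE | now exists d' | now exists e]. }
  rewrite (is_rat_fun S1 R3), E1, E2, (is_rat_fun R2 Ri) in Lt.
  pose proof (Rinv_0_lt_compat _ (INR_S_pos l)). lra.
Qed.

Definition seq_name (F : T -> nat -> triple) : name T :=
  graph_name F (fun v => rat_name T (val v)).

Definition locally_constant (V : Type) (F : T -> nat -> V) : Prop :=
  forall t n, near t (fun s => F s n = F t n).

Lemma seq_name_app F t n q : locally_constant F ->
  pair_name (num n) q \in[t] seq_name F <-> is_rat t q (val (F t n)).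
Proof.
  intro H. unfold seq_name. rewrite (app_graph _ H). unfold is_rat.
  split; [intro E; split; [apply rational_val | exact E] | intros [_ E]; exact E].
Qed.

Lemma seq_name_value F t n : locally_constant F ->
  pair_name (num n) (rat_name T (val (F t n))) \in[t] seq_name F.
Proof. intro H. apply (seq_name_app _ _ _ H), is_rat_name, rational_val. Qed.

Lemma seq_name_sequence F t : locally_constant F -> sequence t (seq_name F).
Proof.
  intro H. apply graph_is_fun; [exact H|]. intros s v. exists (val v).
  apply is_rat_name, rational_val.
Qed.

Lemma seq_name_entry F t n rho : locally_constant F ->
  entry t (seq_name F) n rho <-> rho = val (F t n).
Proof.
  intro H. split.
  - intros (q & Hq & Rq). apply (seq_name_app t n q H) in Hq. exact (is_rat_fun Rq Hq).
  - intros ->. exists (rat_name T (val (F t n))).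
    assert (K : is_rat t (rat_name T (val (F t n))) (val (F t n)))
      by apply is_rat_name, rational_val.
    split; [now apply seq_name_app | exact K].
Qed.

(** Conversely, locally constant sequences have a locally constant distance,
    which is named by its graph. *)
Lemma closer_intro F G t e eps m N :
  locally_constant F -> locally_constant G -> is_rat t e eps ->
  near t (fun s => forall n, (N < n)%nat ->
    Rabs (val (F s n) - val (G s n)) + / INR (S m) < eps) ->
  closer (seq_name F) (seq_name G) e t.
Proof.
  intros HF HG He L.
  set (D := fun (s : T) n => vdist (F s n) (G s n)).
  assert (HD : locally_constant D).
  { intros s n. refine (near_mono _ (near_and (HF s n) (HG s n))).
    intros u [E1 E2]. unfold D. now rewrite E1, E2. }
  destruct He as [[v Hv] Ee].
  set (C := fun (_ : T) (_ : nat) => v).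
  assert (HC : locally_constant C) by (intros s n; now apply near_all).
  assert (Rn : forall s w, is_rat s (rat_name T (val w)) (val w))
    by (intros; apply is_rat_name, rational_val).
  exists (seq_name D). split; [split; [now apply seq_name_sequence|]|].
  { apply near_all. intros s i [n En].
    exists (rat_name T (val (F s n))). rewrite En.
    split; [now apply seq_name_value|].
    exists (rat_name T (val (G s n))). rewrite En.
    split; [now apply seq_name_value|].
    exists (rat_name T (val (D s n))). rewrite En.
    split; [|now apply (seq_name_value (F := D))].
    exists (val (F s n)), (val (G s n)). split; [apply Rn|]. split; [apply Rn|].
    unfold D. rewrite <- val_dist. apply Rn. }
  exists (seq_name C). split; [split; [now apply seq_name_sequence|]|].
  { refine (near_mono _ (eq_at_stable Ee)). intros s Es i [n En]. rewrite En.
    apply seq_name_app; [exact HC|]. split; [apply rational_val|]. unfold C. now rewrite Hv. }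
  exists (num (S m)). split; [exists m; reflexivity|].
  exists (num N). split; [exists N; reflexivity|].
  refine (near_mono _ (near_near L)). intros s Ls i [n En].
  refine (near_mono _ (near_and Ls (eq_at_stable En))). intros u [Lu Eu] Hi.
  apply (nat_mem (reflexivity _) Eu) in Hi.
  exists (rat_name T (val (D u n))). split; [rewrite Eu; apply seq_name_value; assumption|].
  exists (rat_name T (val (C u n))). split; [rewrite Eu; apply seq_name_value; assumption|].
  exists (rat_name T (/ INR (S m))).
  assert (Ri := is_rat_name u (rational_inv m)).
  split; [exists m; split; [reflexivity | exact Ri]|].
  assert (Ra := rational_add (rational_val (D u n)) (rational_inv m)).
  exists (rat_name T (val (D u n) + / INR (S m))).
  assert (Rs := is_rat_name u Ra).
  split; [exists (val (D u n)), (/ INR (S m)); auto|].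
  exists (val (D u n) + / INR (S m)), (val (C u n)).
  split; [exact Rs|]. split; [apply Rn|].
  unfold C, D. rewrite val_dist, Hv. auto.
Qed.

Lemma cauchy_intro F :
  locally_constant F ->
  (forall t eps, 0 < eps -> exists N, near t (fun s => forall n m, (N < n)%nat -> (N < m)%nat ->
     Rabs (val (F s n) - val (F s m)) < eps)) ->
  forall t, cauchy (seq_name F) t.
Proof.
  intros HF HC t. split; [now apply seq_name_sequence|].
  apply near_all. intros s e (eps & He & Pos). destruct (HC s eps Pos) as [N HN].
  exists (num N). split; [exists N; reflexivity|].
  refine (near_mono _ (near_and (near_near HN) (near_near (is_rat_stable He)))).
  intros s1 [H1 He1] i [n En].
  refine (near_mono _ (near_and (near_and (near_near H1) (near_near He1)) (near_near (eq_at_stable En)))).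
  intros s2 [[H2 He2] En2] j [m Em].
  refine (near_mono _ (near_and (near_and H2 He2) (near_and En2 (eq_at_stable Em)))).
  intros u [[Hu Heu] [Enu Emu]] [Ln Lm].
  apply (nat_mem (reflexivity _) Enu) in Ln. apply (nat_mem (reflexivity _) Emu) in Lm.
  assert (Rn : forall w, is_rat u (rat_name T (val w)) (val w))
    by (intros; apply is_rat_name, rational_val).
  exists (rat_name T (val (F u n))). split; [rewrite Enu; apply seq_name_value; assumption|].
  exists (rat_name T (val (F u m))). split; [rewrite Emu; apply seq_name_value; assumption|].
  exists (rat_name T (val (vdist (F u n) (F u m)))). split.
  - exists (val (F u n)), (val (F u m)). split; [apply Rn|]. split; [apply Rn|].
    rewrite <- val_dist. apply Rn.
  - exists (val (vdist (F u n) (F u m))), eps. split; [apply Rn|]. split; [exact Heu|].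
    rewrite val_dist. now apply Hu.
Qed.

Section Transfer.
Variable F : nat -> T -> nat -> triple.
Hypothesis F_loc : forall j, locally_constant (F j).
Hypothesis F_cauchy : forall j t eps, 0 < eps -> exists N, near t (fun s =>
  forall n m, (N < n)%nat -> (N < m)%nat -> Rabs (val (F j s n) - val (F j s m)) < eps).
Hypothesis F_outer : forall t eps, 0 < eps -> exists J, near t (fun s =>
  forall j k, (J < j)%nat -> (J < k)%nat -> exists m N, near s (fun u => forall n, (N < n)%nat ->
    Rabs (val (F j u n) - val (F k u n)) + / INR (S m) < eps)).

Definition rows_name : name T := graph_name (fun _ j => j) (fun j => seq_name (F j)).

Lemma rows_loc : locally_constant (fun (_ : T) (j : nat) => j).
Proof. intros t n. now apply near_all. Qed.

Lemma rows_cauchy t : cauchy_cauchy rows_name t.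
Proof.
  split.
  - apply graph_is_fun; [exact rows_loc|]. intros s j. exact (cauchy_intro (F_loc j) (F_cauchy j) s).
  - apply near_all. intros s e (eps & He & Pos). destruct (F_outer s Pos) as [N HN].
    exists (num N). split; [exists N; reflexivity|].
    refine (near_mono _ (near_and (near_near HN) (near_near (is_rat_stable He)))).
    intros s1 [H1 He1] i [n En].
    refine (near_mono _ (near_and (near_and (near_near H1) (near_near He1)) (near_near (eq_at_stable En)))).
    intros s2 [[H2 He2] En2] j [m Em].
    refine (near_mono _ (near_and (near_and H2 He2) (near_and En2 (eq_at_stable Em)))).
    intros u [[Hu Heu] [Enu Emu]] [Ln Lm].
    apply (nat_mem (reflexivity _) Enu) in Ln. apply (nat_mem (reflexivity _) Emu) in Lm.
    exists (seq_name (F n)). split; [rewrite Enu; now apply (app_graph _ rows_loc)|].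
    exists (seq_name (F m)). split; [rewrite Emu; now apply (app_graph _ rows_loc)|].
    destruct (Hu n m Ln Lm) as (l & M & H). exact (closer_intro (F_loc n) (F_loc m) Heu H).
Qed.

(** The table F, turned into a sequence of sequences of the model, satisfies
    the hypothesis of completeness at every point.  The limit it must have near
    t is a name for a sequence of rationals; y reads off its entries.  They are
    locally constant because what an entry is at a point is forced, hence holds
    on a neighbourhood. *)
Theorem completeness_limit t r : forces r cauchy_completeness t ->
  exists y : T -> nat -> R, near t (fun s =>
    (forall n, near s (fun u => y u n = y s n)) /\
    (forall eps, 0 < eps -> exists J, forall j, (J < j)%nat -> exists N, forall n, (N < n)%nat ->
       Rabs (val (F j s n) - y s n) < eps)).
Proof.
  intro H. apply forces_completeness in H.
  destruct (near_here H _ (rows_cauchy t)) as (b & [Hb _] & Hc).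
  exists (fun s n => epsilon (inhabits 0) (entry s b n)).
  assert (Y : forall s n rho, sequence s b -> entry s b n rho ->
             epsilon (inhabits 0) (entry s b n) = rho).
  { intros s n rho Hs Hn. apply (@entry_fun s b n); trivial.
    apply epsilon_spec. eauto. }
  refine (near_mono _ (near_and (near_near (is_fun_stable Hb)) Hc)).
  intros s [Hs Hcs]. split.
  - intro n. pose proof (near_here Hs) as Hsq. destruct (entry_exists n Hsq) as [rho Hrho].
    refine (near_mono _ (near_and Hs (entry_stable Hrho))). intros u [Hu Eu].
    now rewrite (Y u n rho Hu Eu), (Y s n rho Hsq Hrho).
  - intros eps Pos.
    destruct (archimed_cor1 eps Pos) as (k & Hk & Hk0).
    destruct k as [|k]; [lia|].
    assert (Re := is_rat_name s (rational_inv k)).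
    destruct (Hcs (rat_name T (/ INR (S k)))) as (N & [J EJ] & HJ).
    { exists (/ INR (S k)). split; [exact Re|]. apply Rinv_0_lt_compat, INR_S_pos. }
    exists J. intros j Hj.
    destruct (near_here (near_here HJ (num j) (ex_intro _ j (eq_at_refl s (num j))))) as (c & Ec & Hcl).
    { now apply (nat_mem EJ (reflexivity _)). }
    apply (app_graph _ rows_loc) in Ec.
    destruct (closer_entry Hcl Re) as [M HM]. exists M. intros n Hn.
    destruct (HM n Hn) as (rho & sigma & E1 & E2 & L).
    rewrite (Y s n sigma (near_here Hs) E2).
    destruct E1 as (q & Hq & Rq). rewrite Ec in Hq.
    assert (E1 : entry s (seq_name (F j)) n rho) by (now exists q).
    apply (seq_name_entry s n rho (F_loc j)) in E1. subst rho. lra.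
Qed.

End Transfer.
End Sequences.

(** * Climbing sequences of rationals *)

(** Since the sequence is nondecreasing, a finite part of it bounds its limit
    [top] from below, so a neighbourhood only has to bound it from above. *)
Record climb : Set := Climb {
  step :> nat -> triple;
  top : R;
  step_mono : forall n, val (step n) <= val (step (S n));
  step_top : forall n, val (step n) <= top;
  step_approach : forall eps, 0 < eps -> exists n, top - eps < val (step n) }.

Lemma step_le (z : climb) n m : (n <= m)%nat -> val (z n) <= val (z m).
Proof.
  intro H. induction H; [lra | pose proof (step_mono z m); lra].
Qed.

Lemma step_approach_le (z : climb) eps : 0 < eps ->
  exists n, forall m, (n <= m)%nat -> top z - eps < val (z m).
Proof.
  intro H. destruct (step_approach z H) as [n Hn]. exists n. intros m Hm.
  pose proof (step_le z Hm). lra.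
Qed.

Lemma climb_of (v : nat -> triple) B :
  (forall n, val (v n) <= val (v (S n))) -> (forall n, val (v n) <= B) ->
  exists z : climb, step z = v /\ top z <= B.
Proof.
  intros Hm HB.
  destruct (completeness (fun x => exists n, x = val (v n))) as [l [H1 H2]].
  - exists B. intros x [n ->]. apply HB.
  - exists (val (v 0%nat)), 0%nat. reflexivity.
  - assert (U : forall n, val (v n) <= l) by (intro n; apply H1; eauto).
    assert (A : forall eps, 0 < eps -> exists n, l - eps < val (v n)).
    { intros eps He. apply NNPP. intro N. assert (l <= l - eps); [|lra].
      apply H2. intros x [n ->]. apply Rnot_lt_le. intro L. apply N. now exists n. }
    exists (Climb Hm U A). split; [reflexivity|]. apply H2. intros x [n ->]. apply HB.
Qed.

Definition zero : triple := (0, 0, 0)%nat.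

Lemma val_zero : val zero = 0.
Proof. unfold val, zero. cbn. lra. Qed.

Lemma climb0_exists : exists z : climb, forall n, z n = zero.
Proof.
  destruct (@climb_of (fun _ => zero) 0) as (z & H & _).
  - intro; lra.
  - intro; rewrite val_zero; lra.
  - exists z. intro n. now rewrite H.
Qed.

Lemma rational_dense (x y : R) : 0 <= x -> x < y -> exists v, x < val v < y.
Proof.
  intros Hx Hxy.
  destruct (archimed_cor1 (y - x)) as (k & Hk & Hk0); [lra|].
  destruct k as [|k]; [lia|]. pose proof (INR_S_pos k) as P.
  destruct (archimed (x * INR (S k))) as [U1 U2].
  set (u := Rdefinitions.up (x * INR (S k))) in *.
  assert (0 <= u)%Z. { apply le_IZR. assert (0 <= x * INR (S k)) by nra. lra. }
  exists (Z.to_nat u, 0, k)%nat. unfold val. rewrite INR_IZR_INZ, Znat.Z2Nat.id by assumption.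
  replace (INR 0) with 0 by reflexivity.
  assert (E : (IZR u - 0) / INR (S k) * INR (S k) = IZR u) by (field; lra).
  assert (E' : / INR (S k) * INR (S k) = 1) by (field; lra).
  assert ((y - x) * INR (S k) > 1) by nra.
  split; apply (Rmult_lt_reg_r (INR (S k))); trivial; rewrite E; lra.
Qed.

Lemma dependent_choice (A : Type) (P : nat -> A -> Prop) (R : nat -> A -> A -> Prop) a0 :
  P 0%nat a0 -> (forall n a, P n a -> exists b, P (S n) b /\ R n a b) ->
  exists f : nat -> A, f 0%nat = a0 /\ forall n, P n (f n) /\ R n (f n) (f (S n)).
Proof.
  intros H0 HS.
  set (f := fix f n := match n with 0%nat => a0
    | S k => epsilon (inhabits a0) (fun b => P (S k) b /\ R k (f k) b) end).
  assert (Hf : forall n, P n (f n) -> P (S n) (f (S n)) /\ R n (f n) (f (S n))).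
  { intros n Hn. exact (epsilon_spec (inhabits a0) (fun b => P (S n) b /\ R n (f n) b) (HS n _ Hn)). }
  assert (HP : forall n, P n (f n)).
  { induction n; [exact H0 | now apply Hf]. }
  exists f. split; [reflexivity|]. intro n. split; [apply HP | now apply Hf].
Qed.

Lemma inv_INR_small eps : 0 < eps -> exists N, forall n, (N <= n)%nat -> / INR (S n) < eps.
Proof.
  intro H. destruct (archimed_cor1 eps H) as (N & HN & HN0). exists N. intros n Hn.
  apply Rle_lt_trans with (/ INR N); [|exact HN].
  apply Rinv_le_contravar; [now apply lt_0_INR | apply le_INR; lia].
Qed.

Lemma inv_INR_pos n : 0 < / INR (S n).
Proof. apply Rinv_0_lt_compat, INR_S_pos. Qed.

Definition agree (n : nat) (z z' : climb) : Prop := forall k, (k < n)%nat -> z' k = z k.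

Section Connected.
Variables (b : R) (Q : climb -> Prop).
Hypothesis b_pos : 0 < b.
Hypothesis Q_loc : forall z : climb, z 0%nat = zero -> top z <= b -> exists m, forall z' : climb,
  z' 0%nat = zero -> top z' <= b -> agree m z z' -> Rabs (top z' - top z) < / INR (S m) ->
  (Q z' <-> Q z).

(** Q is guaranteed as long as the first n + 1 entries are kept and the limit
    does not exceed r. *)
Definition safe (n : nat) (z : climb) (r : R) : Prop :=
  top z < r <= b /\ forall z', agree (S n) z z' -> top z' <= r -> Q z'.

(** The finite sequences of the construction are encoded as climbing sequences
    that are constant from n on. *)
Definition extendable (n : nat) (z : climb) : Prop :=
  z 0%nat = zero /\ (forall k, (n <= k)%nat -> z k = z n) /\ exists r, safe n z r.

Lemma top_const n (z : climb) : (forall k, (n <= k)%nat -> z k = z n) -> top z = val (z n).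
Proof.
  intro H. apply Rle_antisym; [|apply step_top]. apply Rnot_lt_le. intro L.
  destruct (@step_approach_le z (top z - val (z n))) as [m Hm]; [lra|].
  assert (m <= max n m)%nat by lia. specialize (Hm _ H0). rewrite (H (max n m)) in Hm by lia. lra.

Qed.

(** One step of the greedy construction: the new limit comes within eps of
    every bound that was safe. *)
Lemma extend n z eps : extendable n z -> 0 < eps -> exists z', extendable (S n) z' /\
  agree (S n) z z' /\ forall r, safe n z r -> r < top z' + eps.
Proof.
  intros (Hz0 & Hc & r0 & Hr0) He.
  destruct (completeness (safe n z)) as [l [L1 L2]].
  { exists b. intros r [H _]. lra. }
  { now exists r0. }
  assert (H : exists r, safe n z r /\ l - eps / 2 < r).
  { apply NNPP. intro N. assert (l <= l - eps / 2); [|lra].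
    apply L2. intros r Hr. apply Rnot_lt_le. intro K. apply N. now exists r. }
  destruct H as (r & [Hr HQ] & Hrl).
  assert (Ht := top_const Hc).
  assert (Hz : 0 <= top z).
  { pose proof (step_top z 0). rewrite Hz0, val_zero in H. exact H. }
  destruct (@rational_dense (Rmax (top z) (r - eps / 2)) r) as (u & Hu1 & Hu2).
  { apply Rle_trans with (1 := Hz). apply Rmax_l. }
  { apply Rmax_lub_lt; lra. }
  assert (Hu : top z < val u) by (pose proof (Rmax_l (top z) (r - eps / 2)); lra).
  assert (Hu' : r - eps / 2 < val u) by (pose proof (Rmax_r (top z) (r - eps / 2)); lra).
  destruct (@climb_of (fun k => if k <=? n then z k else u) r) as (z' & Ez & Tz).
  { intro k. destruct (Nat.leb_spec k n), (Nat.leb_spec (S k) n); try lra; try lia.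
    - apply step_mono.
    - pose proof (step_top z k). lra. }
  { intro k. destruct (Nat.leb_spec k n); [pose proof (step_top z k)|]; lra. }
  assert (Ag : agree (S n) z z').
  { intros k Hk. rewrite Ez. destruct (Nat.leb_spec k n); [reflexivity | lia]. }
  assert (Hc' : forall k, (S n <= k)%nat -> z' k = u).
  { intros k Hk. rewrite Ez. destruct (Nat.leb_spec k n); [lia | reflexivity]. }
  assert (Tu : top z' = val u).
  { rewrite (@top_const (S n) z'); [now rewrite Hc'|]. intros k Hk. now rewrite !Hc' by lia. }
  exists z'. split; [|split; [exact Ag|]].
  - split; [rewrite Ag by lia; exact Hz0|]. split; [intros k Hk; now rewrite !Hc' by lia|].
    exists r. split; [lra|]. intros z2 A2 T2. apply HQ; [|exact T2].
    intros k Hk. rewrite A2 by lia. now apply Ag.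
  - intros r' Hr'. apply L1 in Hr'. lra.
Qed.

(** The property Q of climbing sequences is locally constant for the topology
    of finite parts and limits.  Starting with zeros, add one entry after
    another, each time nearly as large as Q can be guaranteed to allow for all
    the continuations below it.  The limit x of the sequence x so built
    satisfies Q, because x is near the finite stages.  If it were less than b,
    then Q would be guaranteed near x for limits exceeding that of x by a fixed
    amount, and the entries would have risen above the limit of x. *)
Lemma connected (z0 : climb) : (forall n, z0 n = zero) -> Q z0 ->
  exists z : climb, z 0%nat = zero /\ top z = b /\ Q z.
Proof.
  intros Hz0 HQ0.
  assert (T0 : top z0 = 0).
  { rewrite (@top_const 0 z0); [rewrite Hz0; apply val_zero|]. intros; now rewrite !Hz0. }
  (* Some positive bound is safe once n0 zeros are kept. *)
  destruct (Q_loc (Hz0 0%nat)) as [n0 Hn0]; [lra|].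
  assert (I0 : extendable (n0 + 0) z0).
  { split; [apply Hz0|]. split; [intros; now rewrite !Hz0|].
    exists (Rmin b (/ INR (S n0) / 2)). pose proof (inv_INR_pos n0) as P.
    pose proof (Rmin_l b (/ INR (S n0) / 2)). pose proof (Rmin_r b (/ INR (S n0) / 2)).
    split; [split; [rewrite T0; apply Rmin_glb_lt; lra | lra]|].
    intros z' Ag Tz. 
    assert (Z0 : z' 0%nat = zero) by (rewrite Ag by lia; apply Hz0).
    apply Hn0; trivial; [lra | intros k Hk; apply Ag; lia|].
    pose proof (step_top z' 0) as S0. rewrite Z0, val_zero in S0.
    rewrite T0, Rabs_right; lra. }
  destruct (@dependent_choice climb (fun i z => extendable (n0 + i) z)
    (fun i z z' => agree (S (n0 + i)) z z' /\
       forall r, safe (n0 + i) z r -> r < top z' + / INR (S i)) z0 I0) as (Z & _ & HZ).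
  { intros i z Hz. destruct (extend Hz (inv_INR_pos i)) as (z' & H1 & H2 & H3).
    exists z'. rewrite Nat.add_succ_r. auto. }
  assert (Ag : forall i j, (i <= j)%nat -> agree (S (n0 + i)) (Z i) (Z j)).
  { intros i j H. induction H as [|j H IH]; [intros k _; reflexivity|].
    intros k Hk. destruct (HZ j) as (_ & A & _). rewrite A by lia. now apply IH. }
  assert (TZ : forall i, top (Z i) = val (Z i (n0 + i)%nat)).
  { intro i. apply top_const. apply HZ. }
  assert (TZb : forall i, top (Z i) <= b).
  { intro i. destruct (HZ i) as ((_ & _ & r & Hr & _) & _). lra. }
  (* Stage i settles the entries up to n0 + i, so the diagonal collects them. *)
  set (v := fun k => Z k k).
  assert (Ev : forall i k, (k <= n0 + i)%nat -> v k = Z i k).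
  { intros i k Hk. unfold v. destruct (Nat.le_ge_cases i k) as [L | L].
    - apply (Ag i k L). lia.
    - symmetry. apply (Ag k i L). lia. }
  destruct (@climb_of v b) as (x & Ex & Tx).
  { intro k. rewrite (Ev (S k) k), (Ev (S k) (S k)) by lia. apply step_mono. }
  { intro k. rewrite (Ev k k) by lia. apply Rle_trans with (2 := TZb k). apply step_top. }
  assert (TZx : forall i, top (Z i) <= top x).
  { intro i. rewrite TZ, <- Ev by lia. rewrite <- Ex. apply step_top. }
  assert (Agx : forall i, agree (S (n0 + i)) (Z i) x).
  { intros i k Hk. rewrite Ex. apply Ev. lia. }
  assert (X0 : x 0%nat = zero).
  { rewrite (Agx 0%nat) by lia. apply HZ. }
  destruct (Q_loc X0 Tx) as [m Hm].
  pose proof (inv_INR_pos m) as Pm.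
  destruct (step_approach_le x Pm) as [N HN].
  assert (TN : forall i, (N <= i)%nat -> top x - / INR (S m) < top (Z i)).
  { intros i Hi. rewrite TZ, <- Ev by lia. rewrite <- Ex. apply HN. lia. }
  assert (Near : forall i z', (N <= i)%nat -> (m <= i)%nat -> agree (S (n0 + i)) (Z i) z' ->
            top z' <= b -> top z' < top x + / INR (S m) -> (Q z' <-> Q x)).
  { intros i z' H1 H2 A Hb Ht. apply Hm; trivial.
    - rewrite A by lia. apply HZ.
    - intros k Hk. rewrite A by lia. symmetry. apply Agx. lia.
    - assert (top (Z i) <= top z').
      { rewrite TZ, <- A by lia. apply step_top. }
      specialize (TN i H1). apply Rabs_def1; lra. }
  assert (HQx : Q x).
  { apply (Near (max N m) (Z (max N m))); try lia.
    - intros k _. reflexivity.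
    - apply TZb.
    - specialize (TZx (max N m)). lra.
    - destruct (HZ (max N m)) as ((_ & _ & r & Hr & HQ) & _). apply HQ; [intros k _; reflexivity | lra]. }
  exists x. split; [exact X0|]. split; [|exact HQx].
  apply Rle_antisym; [exact Tx|]. apply Rnot_lt_le. intro L.
  (* This bound is safe at all late stages, since a continuation of a late
     stage has a limit close to that of x from below as well. *)
  set (r := Rmin b (top x + / INR (S m) / 2)).
  assert (Hr1 : r <= b) by apply Rmin_l.
  assert (Hr2 : r <= top x + / INR (S m) / 2) by apply Rmin_r.
  assert (Hr3 : top x < r) by (apply Rmin_glb_lt; lra).
  destruct (@inv_INR_small (r - top x)) as [M HM]; [lra|].
  set (i := max M (max N m)).
  assert (G : safe (n0 + i) (Z i) r).
  { split; [specialize (TZx i); lra|]. intros z' A Tz.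
    apply (Near i z'); trivial; try lia; lra. }
  destruct (HZ i) as (_ & _ & K). apply K in G.
  specialize (TZx (S i)). assert (M <= i)%nat as Hi by lia. apply HM in Hi. lra.
Qed.

End Connected.

(** * The space of tables *)

(** Row limits that are eventually equal suffice for the construction, and make
    the sequence of rows Cauchy. *)
Record table : Set := Table {
  row : nat -> climb;
  row_settles : exists J, forall j, (J <= j)%nat -> top (row j) = top (row J) }.

(** The condition on the limits is uniform in the row: this makes the sequence
    of rows Cauchy on a neighbourhood, and two tables with the same limits are
    near each other as soon as they have a long finite part in common. *)
Definition ball (m : nat) (t s : table) : Prop :=
  (forall j, (j < m)%nat -> agree m (row t j) (row s j)) /\
  (forall j, Rabs (top (row s j) - top (row t j)) < / INR (S m)).

Definition table_near (t : table) (P : table -> Prop) : Prop :=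
  exists m, forall s, ball m t s -> P s.

Lemma ball_refl m t : ball m t t.
Proof.
  split; [intros j _ k _; reflexivity|]. intro j.
  rewrite Rminus_diag, Rabs_R0. apply inv_INR_pos.
Qed.

Lemma inv_INR_le n m : (n <= m)%nat -> / INR (S m) <= / INR (S n).
Proof. intro H. apply Rinv_le_contravar; [apply INR_S_pos | apply le_INR; lia]. Qed.

Lemma ball_le n m t s : (n <= m)%nat -> ball m t s -> ball n t s.
Proof.
  intros H [A B]. pose proof (inv_INR_le H). split.
  - intros j Hj k Hk. apply A; lia.
  - intro j. specialize (B j). lra.
Qed.

Lemma ball_trans m t s u : ball (2 * m + 1) t s -> ball (2 * m + 1) s u -> ball m t u.
Proof.
  intros [A B] [A' B']. split.
  - intros j Hj k Hk. rewrite A' by lia. apply A; lia.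
  - intro j. specialize (B j). specialize (B' j).
    assert (E : / INR (S (2 * m + 1)) = / INR (S m) / 2).
    { replace (S (2 * m + 1)) with (2 * S m)%nat by lia. rewrite mult_INR.
      pose proof (INR_S_pos m). replace (INR 2) with 2 by (cbn; lra). field. lra. }
    rewrite E in B, B'.
    replace (top (row u j) - top (row t j)) with
      ((top (row u j) - top (row s j)) + (top (row s j) - top (row t j))) by ring.
    eapply Rle_lt_trans; [apply Rabs_triang | lra].
Qed.

Definition tables : space.
Proof.
  refine (@Space table table_near _ _ _ _ _).
  - intros t P [m H]. apply H, ball_refl.
  - intros t P H. exists 0%nat. auto.
  - intros t P Q H [m K]. exists m. auto.
  - intros t P Q [m H] [n K]. exists (max m n). intros s Hs.
    split; [apply H | apply K]; revert Hs; apply ball_le; lia.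
  - intros t P [m H]. exists (2 * m + 1)%nat. intros s Hs.
    exists (2 * m + 1)%nat. intros u Hu. apply H. exact (ball_trans Hs Hu).
Defined.

Definition rows (j : nat) (t : tables) (n : nat) : triple := row t j n.

Lemma rows_locally_constant j : locally_constant (rows j).
Proof.
  intros t n. exists (S (max j n)). intros s [A _]. apply (A j); lia.
Qed.

Lemma rows_near (t : tables) j eps : 0 < eps -> exists N, near t (fun s =>
  forall n, (N < n)%nat -> Rabs (val (rows j s n) - top (row t j)) < eps).
Proof.
  intro He. destruct (step_approach_le (row t j) He) as [N HN].
  destruct (inv_INR_small He) as [M HM].
  exists N. exists (S (max (max j N) M)). intros s [A B] n Hn. unfold rows.
  specialize (B j). pose proof (HM (S (max (max j N) M))) as L.
  apply Rabs_def2 in B. pose proof (step_top (row s j) n).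
  assert (val (row s j N) <= val (row s j n)) by (apply step_le; lia).
  rewrite (A j) in H0 by lia. specialize (HN N (le_n _)).
  assert (/ INR (S (S (max (max j N) M))) < eps) by (apply L; lia).
  apply Rabs_def1; lra.
Qed.

Lemma Rabs_near x y z e : Rabs (x - z) < e -> Rabs (y - z) < e -> Rabs (x - y) < 2 * e.
Proof. intros H K. apply Rabs_def2 in H, K. apply Rabs_def1; lra. Qed.

Lemma rows_inner_cauchy j (t : tables) eps : 0 < eps -> exists N, near t (fun s =>
  forall n m, (N < n)%nat -> (N < m)%nat ->
    Rabs (val (rows j s n) - val (rows j s m)) < eps).
Proof.
  intro He. destruct (@rows_near t j (eps / 2)) as [N HN]; [lra|].
  exists N. revert HN. apply near_mono. intros s H n m Hn Hm.
  replace eps with (2 * (eps / 2)) by field.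
  apply (@Rabs_near _ _ (top (row t j))); auto.
Qed.

(** Near t the limits of the late rows differ by little, because those of t
    agree and the change of limits is uniform.  How late the entries must be
    taken depends on the pair of rows, and on a smaller neighbourhood. *)
Lemma rows_outer_cauchy (t : tables) eps : 0 < eps -> exists J, near t (fun s =>
  forall j k, (J < j)%nat -> (J < k)%nat -> exists m N, near s (fun u =>
    forall n, (N < n)%nat ->
      Rabs (val (rows j u n) - val (rows k u n)) + / INR (S m) < eps)).
Proof.
  intro He. destruct (row_settles t) as [J HJ]. exists J.
  destruct (@inv_INR_small (eps / 8)) as [M HM]; [lra|].
  exists M. intros s [_ B] j k Hj Hk. exists M.
  destruct (@rows_near s j (eps / 8)) as [N1 H1]; [lra|].
  destruct (@rows_near s k (eps / 8)) as [N2 H2]; [lra|].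
  exists (max N1 N2). refine (near_mono _ (near_and H1 H2)). intros u [K1 K2] n Hn.
  specialize (K1 n). specialize (K2 n).
  assert (Bj := B j). assert (Bk := B k). specialize (HM M (le_n _)).
  rewrite (HJ j) in Bj by lia. rewrite (HJ k) in Bk by lia.
  pose proof (@Rabs_near _ _ _ _ Bj Bk) as Bjk. apply Rabs_def2 in Bjk.
  assert (Q1 := K1 ltac:(lia)). assert (Q2 := K2 ltac:(lia)). apply Rabs_def2 in Q1, Q2.
  enough (Rabs (val (rows j u n) - val (rows k u n)) < 5 * (eps / 8)) by lra.
  apply Rabs_def1; lra.
Qed.

Lemma splice_settles (base : nat -> climb) J (z : climb) : exists N, forall j, (N <= j)%nat ->
  top (if j <? J then base j else z) = top (if N <? J then base N else z).
Proof.
  exists J. intros j Hj. rewrite Nat.ltb_irrefl. destruct (Nat.ltb_spec j J); [lia | reflexivity].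
Qed.

(** The first J rows of base, followed by copies of z. *)
Definition splice (base : nat -> climb) J (z : climb) : tables :=
  Table (splice_settles base J z).

Lemma row_splice base J z j : row (splice base J z) j = if j <? J then base j else z.
Proof. reflexivity. Qed.

Section NoLimit.
Variables (z0 : climb) (y : tables -> nat -> R) (m0 : nat).
Hypothesis z0_zero : forall n, z0 n = zero.
Let origin : tables := splice (fun _ => z0) 0 z0.
Hypothesis y_loc : forall t : tables, ball m0 origin t -> forall n, near t (fun u => y u n = y t n).
Hypothesis y_lim : forall t : tables, ball m0 origin t -> forall eps, 0 < eps ->
  exists J, forall j, (J < j)%nat -> exists N, forall n, (N < n)%nat ->
    Rabs (val (rows j t n) - y t n) < eps.

Let b : R := / INR (S (S m0)).

(** The first m0 rows are zero to stay in the given ball about the zero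
    table. *)
Let state (s : (nat -> climb) * nat) : Prop :=
  let (base, J) := s in (m0 <= J)%nat /\ (forall j, (j < m0)%nat -> base j = z0) /\
  (forall j, (m0 <= j)%nat -> (j < J)%nat -> top (base j) = b).

(** The first rows of s' guarantee, for tables whose other rows have limit b,
    that some y_n with n >= k is below b / 2.  They extend the first rows of s. *)
Let spoils (k : nat) (s s' : (nat -> climb) * nat) : Prop :=
  (snd s < snd s')%nat /\ (forall j, (j < snd s)%nat -> fst s' j = fst s j) /\
  exists n, (k <= n)%nat /\ forall t : tables,
    (forall j, (j < snd s')%nat -> row t j = fst s' j) ->
    (forall j, (snd s' <= j)%nat -> top (row t j) = b) -> y t n < b / 2.

Lemma top_z0 : top z0 = 0.
Proof.
  rewrite (@top_const 0 z0); [rewrite z0_zero; apply val_zero|]. intros; now rewrite !z0_zero.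
Qed.

Lemma b_bounds : 0 < b < / INR (S m0).
Proof.
  split; [apply inv_INR_pos|]. apply Rinv_lt_contravar.
  - apply Rmult_lt_0_compat; apply INR_S_pos.
  - apply lt_INR. lia.
Qed.

Lemma in_ball (t : tables) : (forall j, (j < m0)%nat -> row t j = z0) ->
  (forall j, 0 <= top (row t j) <= b) -> ball m0 origin t.
Proof.
  intros H K. pose proof b_bounds. split.
  - intros j Hj k Hk. rewrite H by assumption. reflexivity.
  - intro j. specialize (K j). change (row origin j) with z0.
    rewrite top_z0. apply Rabs_def1; lra.
Qed.

Lemma splice_in_ball base J (z : climb) : state (base, J) -> z 0%nat = zero -> top z <= b ->
  ball m0 origin (splice base J z).
Proof.
  intros (HJ & H0 & Hb) Hz Tz. pose proof b_bounds as B. apply in_ball; intros j.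
  - intro Hj. rewrite row_splice. destruct (Nat.ltb_spec j J); [now apply H0 | lia].
  - rewrite row_splice. destruct (Nat.ltb_spec j J).
    + destruct (Nat.lt_ge_cases j m0) as [L | L].
      * rewrite H0 by assumption. rewrite top_z0. lra.
      * rewrite Hb by assumption. lra.
    + pose proof (step_top z 0) as S0. rewrite Hz, val_zero in S0. lra.
Qed.

Lemma spoil k s : state s -> exists s', state s' /\ spoils k s s'.
Proof.
  destruct s as [base J]. intro Hs. pose proof b_bounds as B.
  assert (V0 : ball m0 origin (splice base J z0)).
  { apply splice_in_ball; [exact Hs | apply z0_zero | rewrite top_z0; lra]. }
  destruct (y_lim V0 (eps := b / 4)) as [J0 HJ0]; [lra|].
  destruct (HJ0 (S (max J J0))) as [N HN]; [lia|].
  set (n := S (max k N)).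
  assert (Y0 : y (splice base J z0) n < b / 2).
  { specialize (HN n). unfold rows in HN. rewrite row_splice in HN.
    destruct (Nat.ltb_spec (S (max J J0)) J); [lia|].
    rewrite z0_zero, val_zero in HN. assert (K := HN ltac:(lia)). apply Rabs_def2 in K. lra. }
  (* All the rows from J on are raised at once, as copies of one row z, so that
     the argument takes place among climbing sequences. *)
  destruct (@connected b (fun z => y (splice base J z) n < b / 2)) with (z0 := z0)
    as (z & Hz & Tz & Yz); [lra | | exact z0_zero | exact Y0 |].
  { intros z Hz Tz.
    destruct (y_loc (splice_in_ball Hs Hz Tz) n) as [m Hm]. exists m.
    intros z' Hz' Tz' A D. rewrite (Hm (splice base J z')); [reflexivity|]. split.
    - intros j Hj i Hi. rewrite !row_splice.
      destruct (j <? J); [reflexivity | now apply A].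
    - intro j. rewrite !row_splice. destruct (j <? J); [|exact D].
      rewrite Rminus_diag, Rabs_R0. apply inv_INR_pos. }
  destruct (y_loc (splice_in_ball Hs Hz (Req_le _ _ Tz)) n) as [m Hm].
  exists (row (splice base J z), max (S J) m). split; [|split; [|split]].
  - destruct Hs as (HJ & H0 & Hb). split; [lia|]. split.
    + intros j Hj. rewrite row_splice. destruct (Nat.ltb_spec j J); [now apply H0 | lia].
    + intros j Hj _. rewrite row_splice. destruct (Nat.ltb_spec j J); [now apply Hb | exact Tz].
  - cbn [snd]. lia.
  - cbn [fst snd]. intros j Hj. rewrite row_splice. destruct (Nat.ltb_spec j J); [reflexivity | lia].
  - exists n. split; [lia|]. cbn [fst snd]. intros t Ht Hb'. rewrite (Hm t); [exact Yz|]. split.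
    + intros j Hj i Hi. rewrite Ht by lia. reflexivity.
    + intro j. destruct (Nat.lt_ge_cases j (max (S J) m)) as [L | L].
      * rewrite Ht by exact L. rewrite Rminus_diag, Rabs_R0. apply inv_INR_pos.
      * rewrite Hb' by exact L. rewrite row_splice. destruct (Nat.ltb_spec j J); [lia|].
        rewrite Tz, Rminus_diag, Rabs_R0. apply inv_INR_pos.
Qed.

Lemma no_limit : False.
Proof.
  destruct (@dependent_choice _ (fun _ => state) spoils (fun _ => z0, m0)) as (f & _ & Hf).
  { split; [lia|]. split; [reflexivity | intros; lia]. }
  { intros k s Hs. exact (spoil k Hs). }
  assert (HJ : forall i, (i < snd (f (S i)))%nat).
  { induction i as [|i IH].
    - destruct (Hf 0%nat) as [_ [L _]]. lia.
    - destruct (Hf (S i)) as [_ [L _]]. lia. }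
  assert (HJle : forall i k, (i <= k)%nat -> (snd (f i) <= snd (f k))%nat).
  { intros i k H. induction H as [|k H IH]; [lia|]. destruct (Hf k) as [_ [L _]]. lia. }
  assert (Ag : forall i k, (i <= k)%nat -> forall j, (j < snd (f i))%nat -> fst (f k) j = fst (f i) j).
  { intros i k H. induction H as [|k H IH]; [reflexivity|]. intros j Hj.
    destruct (Hf k) as [_ [_ [A _]]]. rewrite A; [now apply IH|]. pose proof (HJle i k H). lia. }
  (* Row j is settled at stage j + 1 at the latest. *)
  set (rw := fun j => fst (f (S j)) j).
  assert (Hrw : forall i j, (j < snd (f i))%nat -> rw j = fst (f i) j).
  { intros i j Hj. unfold rw. destruct (Nat.le_ge_cases i (S j)) as [L | L].
    - now apply Ag.
    - symmetry. apply Ag; [exact L | apply HJ]. }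
  assert (Top : forall j, (m0 <= j)%nat -> top (rw j) = b).
  { intros j Hj. destruct (Hf (S j)) as [Hs _]. destruct (f (S j)) as [base J] eqn:E.
    destruct Hs as (_ & _ & K). unfold rw. rewrite E. apply K; [exact Hj|].
    pose proof (HJ j) as L. rewrite E in L. exact L. }
  assert (Low : forall j, (j < m0)%nat -> rw j = z0).
  { intros j Hj. destruct (Hf (S j)) as [Hs _]. unfold rw. destruct (f (S j)) as [base J].
    now apply Hs. }
  assert (St : exists J, forall j, (J <= j)%nat -> top (rw j) = top (rw J)).
  { exists m0. intros j Hj. now rewrite !Top by lia. }
  pose proof b_bounds as B.
  set (t := Table St : tables).
  assert (V : ball m0 origin t).
  { apply in_ball; [exact Low|]. intro j. change (row t j) with (rw j).
    destruct (Nat.lt_ge_cases j m0) as [L | L]; [rewrite Low, top_z0 by exact L | rewrite Top by exact L]; lra. }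
  destruct (y_lim V (eps := b / 4)) as [J HJ']; [lra|].
  destruct (HJ' (S (max m0 J))) as [N HN]; [lia|].
  destruct (@step_approach_le (rw (S (max m0 J))) (b / 4)) as [M HM]; [lra|].
  rewrite Top in HM by lia.
  destruct (Hf (S (max N M))) as [_ (_ & _ & n & Hn & Hy)].
  assert (Yn : y t n < b / 2).
  { apply Hy.
    - intros j Hj. now apply Hrw.
    - intros j Hj. apply Top. destruct (Hf (S (S (max N M)))) as [Hs _].
      destruct (f (S (S (max N M)))) as [base J2]. destruct Hs. cbn in Hj. lia. }
  assert (K1 := HN n ltac:(lia)). assert (K2 := HM n ltac:(lia)).
  change (rows (S (max m0 J)) t n) with (rw (S (max m0 J)) n) in K1.
  apply Rabs_def2 in K1. lra.
Qed.

End NoLimit.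

Theorem theorem4p1 : cconsistent ZF -> ~ iprovable IZFRef cauchy_completeness.
Proof.
  intros _ H. destruct climb0_exists as [z0 Hz0].
  set (origin := splice (fun _ => z0) 0 z0).
  destruct (completeness_limit rows_locally_constant rows_inner_cauchy rows_outer_cauchy
    (iprovable_forced (fun _ => empty_name tables) origin H)) as (y & m0 & Hy).
  apply (@no_limit z0 y m0 Hz0); intros t Ht; apply (Hy t Ht).
Qed.
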